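(* Let $\Omega=[0,1]$ and let $\nu=\mathcal{L}^1\llcorner[0,1]$ be the Lebesgue measure on $[0,1]$. Then, for any sequence $\{\Sigma'_n\}_{n\ge1}$ of solutions to the short-term optimal location problem, with $s_n:=F(\Sigma'_n)$, the bounded sequence $\{n s_n\}$ does not converge to a limit as $n\to\infty$. Further, for any sequence $\{\Sigma'_n\}_{n\ge1}$ of solutions to the short-term optimal location problem, the sequence of probability measures $\mu_{\Sigma'_n}$ has infinitely many limit measures in the weak$^*$ sense as $n\to\infty$.
   Context: For a finite nonempty set $\Sigma\subset[0,1]$ put $F(\Sigma):=\int_0^1 \mathrm{dist}(x,\Sigma)\,dx$ and $\mu_\Sigma:=\frac{1}{\#\Sigma}\sum_{x\in\Sigma}\delta_x$, a Borel probability measure on $[0,1]$. A sequence of solutions to the short-term optimal location problem is a sequence $\{\Sigma'_n\}_{n\ge1}$ such that, with $\Sigma'_0:=\emptyset$, for each $n\ge1$ the set $\Sigma'_n$ minimizes $F$ among all nonempty sets $\Sigma$ with $\Sigma'_{n-1}\subset\Sigma\subset[0,1]$ and $\#\Sigma\le n$. A limit measure of a sequence of probability measures on $[0,1]$ in the weak$^*$ sense is a weak$^*$ limit (i.e. limit tested against continuous functions on $[0,1]$) of some subsequence. *)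

(* Defs.v *)
From HB Require Import structures.
From mathcomp Require Import all_boot all_order all_algebra finmap.
From mathcomp Require Import all_classical all_reals all_analysis.

Set Implicit Arguments.
Unset Strict Implicit.
Unset Printing Implicit Defensive.

Import Order.TTheory GRing.Theory Num.Theory.
Import numFieldNormedType.Exports.

Local Open Scope classical_set_scope.
Local Open Scope ring_scope.
Local Open Scope fset_scope.

Section optimal_location.
Context {R : realType}.

(* The distance is finite for A != fset0; only such A matter below. *)
Definition dist_set (A : {fset R}) (x : R) : R := fine (edist_inf [set` A] x).

Definition avg_dist (A : {fset R}) : R :=
  (\int[@lebesgue_measure R]_(x in `[0, 1]) dist_set A x)%R.

Definition admissible (B : {fset R}) (n : nat) (A : {fset R}) : Prop :=
  [/\ A != fset0, B `<=` A, {subset A <= `[0, 1]} & (#|` A| <= n)%N].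

(* S n is the n-th configuration for n >= 1; index 0 carries the convention
   that the sequence starts from the empty set. *)
Definition short_term_solutions (S : nat -> {fset R}) : Prop :=
  S 0%N = fset0 /\
  forall n : nat, admissible (S n) n.+1 (S n.+1) /\
    forall A : {fset R}, admissible (S n) n.+1 A ->
      avg_dist (S n.+1) <= avg_dist A.

Definition unif_measure (A : {fset R}) :
    {measure set (measurableTypeR R) -> \bar R} :=
  mscale (#|` A|%:R^-1)%:nng
    (msum (fun i => dirac (nth 0 (enum_fset A) i : measurableTypeR R)) #|` A|).

Lemma unif_measureT (A : {fset R}) : A != fset0 -> unif_measure A setT = 1%E.
Proof.
rewrite -cardfs_gt0 => A0.
have -> : unif_measure A setT =
    ((#|` A|%:R^-1)%:E * \sum_(k < #|` A|) dirac A`_k setT)%E by [].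
rewrite (eq_bigr (fun=> 1%:E)) => [|k _]; last by rewrite diracT.
by rewrite sumEFin sumr_const card_ord -EFinM mulVf// pnatr_eq0 -lt0n.
Qed.

(* Probability measures on [0, 1] are represented by the Borel probability
   measures on R giving full mass to [0, 1]. *)
Definition limit_measure
    (m_ : nat -> {measure set (measurableTypeR R) -> \bar R})
    (m : probability (measurableTypeR R) R) : Prop :=
  m `[0, 1]%classic = 1%E /\
  exists2 phi : nat -> nat, increasing_seq phi &
    forall f : R -> R, {within `[0, 1], continuous f} ->
      (\int[m_ (phi k)]_(x in `[0, 1]) f x)%R @[k --> \oo] -->
      (\int[m]_(x in `[0, 1]) f x)%R.

(* A library measure is a function on all sets, with arbitrary values outside
   the sigma-algebra; as a Borel measure it is determined by this restriction,
   which is what has to be used when counting measures. *)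
Definition on_borel (m : probability (measurableTypeR R) R)
    (B : {B : set (measurableTypeR R) | measurable B}) : \bar R :=
  m (sval B).

End optimal_location.

(* Main.v *)
Require Import Defs.
From HB Require Import structures.
From mathcomp Require Import all_boot all_order all_algebra finmap.
From mathcomp Require Import all_classical all_reals all_analysis.
From mathcomp Require Import measurable_realfun.
From mathcomp Require Import ring lra zify.

Set Implicit Arguments.
Unset Strict Implicit.
Unset Printing Implicit Defensive.

Import Order.TTheory GRing.Theory Num.Theory.
Import numFieldNormedType.Exports.

Local Open Scope classical_set_scope.
Local Open Scope ring_scope.

(* Adding a point to an interior interval of length g lowers F by at most g^2/8
   (at its midpoint), and adding one to an end interval of length e lowers it by
   at most e^2/3 (at one third of it from the boundary).  So the greedy sequence
   reaches {1/6, 1/2, 5/6}, and from then on [1/6, 5/6] is only ever cut by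
   bisection: for every m there is a time N at which its points form the grid of
   step h = 1/(3 * 2^m) and at which h^2/8 is the best possible gain.  The lengths
   of the outer intervals have the form 1/(9c) and 1/(6d), and divisibility by 3
   shows that they never give exactly that gain.  Hence the next 2^(m+1) steps
   bisect the intervals of the grid, each with gain h^2/8.

   During such a phase F is affine in n, so n * F is quadratic in n, and its second
   difference over a half phase is the constant -1/36: n * F does not converge.
   All new points lie in [1/6, 5/6] while a fixed fraction of the old ones lies
   near the boundary, so the mean over the n-th set of a plateau function equal to
   1 on [1/6, 5/6] increases by a fixed amount.  This mean varies slowly, so its
   cluster values fill an interval.  All gaps are at most 6/n, so the quantile
   functions of the uniform measures are asymptotically Lipschitz, and
   every subsequence of these measures has a weak* limit measure; thus each cluster
   value is the integral of the plateau function for some limit measure. *)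

(** * Distance to a finite set and gain of an additional point *)

Section dist.
Context {R : realType}.
Implicit Types (A B : {fset R}) (x y p q u v w : R).

Lemma edist_real x y : edist (x, y) = `|x - y|%:E.
Proof.
apply/eqP; rewrite eq_le; apply/andP; split.
  apply/lee_addgt0Pr => e e0; rewrite -EFinD; apply: edist_fin.
    by rewrite ltr_wpDl.
  by rewrite /ball/= ltrDl.
rewrite leNgt; apply/negP => /edist_lt_ball; rewrite /ball/=.
by rewrite ltxx.
Qed.

Lemma exists_argmin (f : R -> R) (s : seq R) : s != [::] ->
  exists2 a, a \in s & {in s, forall b, f a <= f b}.
Proof.
elim: s => // a [_ _|b s IH _].
  by exists a; rewrite ?mem_head// => b /[!inE]/eqP->.
have [//|c cs cmin] := IH.
have [ac|ca] := leP (f a) (f c).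
  exists a; first exact: mem_head.
  by move=> d; rewrite inE => /predU1P[->//|/cmin]; exact: le_trans.
exists c; first by rewrite inE cs orbT.
by move=> d; rewrite inE => /predU1P[->|/cmin//]; exact: ltW.
Qed.

Lemma fset_argmin (f : R -> R) A : A != fset0 ->
  exists2 a, a \in A & {in A, forall b, f a <= f b}.
Proof.
by move=> A0; apply: exists_argmin; rewrite -size_eq0 -[size _]/(#|` A|) cardfs_eq0.
Qed.

(** A finite set attains the infimum in [dist_set], so later estimates can work with a nearest
    point. *)
Lemma dist_setP A x : A != fset0 ->
  exists a, [/\ a \in A, dist_set A x = `|x - a| &
    {in A, forall b, dist_set A x <= `|x - b|}].
Proof.
move=> /(fset_argmin (fun a => `|x - a|))[a aA amin].
have -> : dist_set A x = `|x - a|; last by exists a.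
rewrite /dist_set (_ : edist_inf _ _ = `|x - a|%:E)//.
apply/eqP; rewrite eq_le; apply/andP; split.
  by apply: ereal_inf_lbound; exists a; rewrite // edist_real.
by apply: le_ereal_inf_tmp => _ [b /= bA <-]; rewrite edist_real lee_fin amin.
Qed.

Lemma dist_set_le A x a : a \in A -> dist_set A x <= `|x - a|.
Proof.
move=> aA; have /(dist_setP x)[b [_ _]] : A != fset0 by apply/fset0Pn; exists a.
exact.
Qed.

Lemma dist_set_ge A x (r : R) : A != fset0 -> {in A, forall a, r <= `|x - a|} ->
  r <= dist_set A x.
Proof. by move=> /(dist_setP x)[a [aA -> _]]; exact. Qed.

Lemma dist_set_ge0 A x : 0 <= dist_set A x.
Proof. by rewrite /dist_set fine_ge0// edist_inf_ge0. Qed.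

Lemma dist_setU1 A x y : A != fset0 ->
  dist_set (y |` A)%fset x = Num.min (dist_set A x) `|x - y|.
Proof.
move=> A0; apply/eqP; rewrite eq_le le_min; apply/andP; split.
  rewrite dist_set_le ?fset1U1// andbT.
  by apply: dist_set_ge => // a aA; rewrite dist_set_le// fset1Ur.
apply: dist_set_ge; first by apply/fset0Pn; exists y; rewrite fset1U1.
move=> a /fset1UP[->|aA]; first by rewrite ge_min lexx orbT.
by rewrite ge_min dist_set_le.
Qed.

Lemma continuous_dist_set A : A != fset0 -> continuous (dist_set A).
Proof.
move=> A0 x; apply/cvgrPdist_le => /= e e0; near=> z.
have xz : `|x - z| <= e by near: z; exact: cvgr_dist_le.
apply: le_trans xz.
have [a [aA xa _]] := dist_setP x A0; have [b [bA zb _]] := dist_setP z A0.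
have := dist_set_le x bA; have := dist_set_le z aA.
have := ler_distD z x b; have := ler_distD x z a.
by rewrite (distrC z x) xa zb => *; rewrite ler_norml; lra.
Unshelve. all: by end_near. Qed.


(** * Integrals of the distance over subintervals *)

Local Notation mu := (@lebesgue_measure R).

Definition interval_dist A u v := \int[mu]_(x in `[u, v]) dist_set A x.

Lemma integrable_dist_set A u v : A != fset0 ->
  mu.-integrable `[u, v] (EFin \o dist_set A).
Proof.
move=> A0; apply: continuous_compact_integrable; first exact: segment_compact.
by apply: continuous_subspaceT; exact: continuous_dist_set.
Qed.

Lemma interval_distD A u v w : A != fset0 -> u <= v -> v <= w ->
  interval_dist A u w = interval_dist A u v + interval_dist A v w.
Proof.
move=> A0 uv vw; rewrite /interval_dist.
have := @Rintegral_itvB R (dist_set A) (BLeft u) (BRight w) v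
  (integrable_dist_set u w A0).
rewrite !bnd_simp => /(_ uv vw)/(canRL (subrK _))->; rewrite addrC; congr (_ + _).
rewrite Rintegral_itv_obnd_cbnd//.
by apply: integrableS (integrable_dist_set v w A0) => //; exact: subset_itv_oc_cc.
Qed.

Lemma eq_interval_dist A B u v : {in `[u, v], dist_set A =1 dist_set B} ->
  interval_dist A u v = interval_dist B u v.
Proof. by move=> AB; apply: eq_Rintegral => x; rewrite inE/= => /AB. Qed.

Lemma Rintegral_linear (c s u v : R) : u <= v ->
  \int[mu]_(x in `[u, v]) (c + s * x) = c * (v - u) + s * (v ^+ 2 - u ^+ 2) / 2.
Proof.
(* The fundamental theorem of calculus is applied with [u < v]; the degenerate interval is treated
   first. *)
rewrite le_eqVlt => /predU1P[->|uv].
  by rewrite set_itv1 Rintegral_set1; ring.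
pose F x : R := c * x + s * (x ^+ 2) / 2.
have dF x : is_derive x (1:R) F (c + s * x).
  rewrite /F; apply: is_derive_eq; rewrite /GRing.scale/=; by field.
have cF : continuous F.
  by move=> x; apply: differentiable_continuous; apply/derivable1_diffP.
rewrite /Rintegral (@continuous_FTC2 _ _ F)//=.
- by rewrite /F; field.
- apply: continuous_subspaceT => x; apply: cvgD; first exact: cvg_cst.
  by apply: cvgM; [exact: cvg_cst|exact: cvg_id].
- split; first by move=> x _.
    exact/cvg_at_right_filter/cF.
  exact/cvg_at_left_filter/cF.
- by move=> x _; rewrite derive1E derive_val.
Qed.

Lemma interval_dist_linear A (c s : R) u v : u <= v ->
  {in `[u, v], forall x, dist_set A x = c + s * x} ->
  interval_dist A u v = c * (v - u) + s * (v ^+ 2 - u ^+ 2) / 2.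
Proof.
move=> uv Acs; rewrite -Rintegral_linear//.
by apply: eq_Rintegral => x; rewrite inE/= => /Acs.
Qed.

Definition gap A p q :=
  [/\ p \in A, q \in A, p < q & {in A, forall x, (x <= p) || (q <= x)}].

(** On each half of the gap the nearest point is the adjacent endpoint, so the graph is a tent of
    base [q - p] and height [(q - p) / 2]. *)
Lemma interval_dist_gap A p q : gap A p q ->
  interval_dist A p q = (q - p) ^+ 2 / 4.
Proof.
move=> [pA qA pq pAq]; have A0 : A != fset0 by apply/fset0Pn; exists p.
rewrite (@interval_distD _ _ ((p + q) / 2))//; [|lra|lra].
rewrite (@interval_dist_linear _ (- p) 1)//; [|lra|]; last first.
  move=> x; rewrite in_itv/= => xp; apply/eqP; rewrite eq_le; apply/andP; split.
    by rewrite (le_trans (dist_set_le x pA))// ger0_norm; lra.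
  apply: dist_set_ge => // y /pAq /orP yq.
  by rewrite ler_normr; case: yq => yp; apply/orP; [left|right]; lra.
rewrite (@interval_dist_linear _ q (-1))//; [by field|lra|].
move=> x; rewrite in_itv/= => xp; apply/eqP; rewrite eq_le; apply/andP; split.
  by rewrite (le_trans (dist_set_le x qA))// ler0_norm; lra.
apply: dist_set_ge => // y /pAq /orP yq.
by rewrite ler_normr; case: yq => yp; apply/orP; [left|right]; lra.
Qed.

Definition is_least A p := p \in A /\ {in A, forall x, p <= x}.
Definition is_greatest A p := p \in A /\ {in A, forall x, x <= p}.

Lemma interval_dist_least A p u : is_least A p -> u <= p ->
  interval_dist A u p = (p - u) ^+ 2 / 2.
Proof.
move=> [pA Ap] up; have A0 : A != fset0 by apply/fset0Pn; exists p.
rewrite (@interval_dist_linear _ p (-1))//; first by field.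
move=> x; rewrite in_itv/= => xp; apply/eqP; rewrite eq_le; apply/andP; split.
  by rewrite (le_trans (dist_set_le x pA))// ler0_norm; lra.
by apply: dist_set_ge => // y /Ap py; rewrite ler_normr; apply/orP; right; lra.
Qed.

Lemma interval_dist_greatest A p u : is_greatest A p -> p <= u ->
  interval_dist A p u = (u - p) ^+ 2 / 2.
Proof.
move=> [pA Ap] up; have A0 : A != fset0 by apply/fset0Pn; exists p.
rewrite (@interval_dist_linear _ (-p) 1)//; first by field.
move=> x; rewrite in_itv/= => xp; apply/eqP; rewrite eq_le; apply/andP; split.
  by rewrite (le_trans (dist_set_le x pA))// ger0_norm; lra.
by apply: dist_set_ge => // y /Ap py; rewrite ler_normr; apply/orP; left; lra.
Qed.

(** To the left of [p], a point beyond [p] is never nearer than [p]. Hence an addition changes the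
    integral only over the interval that receives it. *)
Lemma interval_distU1_left A p y u : p \in A -> p <= y ->
  interval_dist (y |` A)%fset u p = interval_dist A u p.
Proof.
move=> pA py; have A0 : A != fset0 by apply/fset0Pn; exists p.
apply: eq_interval_dist => x; rewrite in_itv/= => xp.
rewrite dist_setU1//; apply: min_l; apply: le_trans (dist_set_le x pA) _.
by rewrite !ler0_norm; lra.
Qed.

Lemma interval_distU1_right A p y u : p \in A -> y <= p ->
  interval_dist (y |` A)%fset p u = interval_dist A p u.
Proof.
move=> pA py; have A0 : A != fset0 by apply/fset0Pn; exists p.
apply: eq_interval_dist => x; rewrite in_itv/= => xp.
rewrite dist_setU1//; apply: min_l; apply: le_trans (dist_set_le x pA) _.
by rewrite !ger0_norm; lra.
Qed.

(** * Gain of an additional point *)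

Definition gain A y := avg_dist A - avg_dist (y |` A)%fset.

Lemma gapU1l A p q y : gap A p q -> p < y < q -> gap (y |` A)%fset p y.
Proof.
move=> [pA qA pq pAq] /andP[py yq]; split => //; rewrite ?fset1U1 ?fset1Ur//.
move=> x /fset1UP[->|/pAq/orP[->//|qx]]; rewrite ?lexx ?orbT//.
by apply/orP; right; lra.
Qed.

Lemma gapU1r A p q y : gap A p q -> p < y < q -> gap (y |` A)%fset y q.
Proof.
move=> [pA qA pq pAq] /andP[py yq]; split => //; rewrite ?fset1U1 ?fset1Ur//.
move=> x /fset1UP[->|/pAq/orP[qx|->]]; rewrite ?lexx ?orbT//.
by apply/orP; left; lra.
Qed.

(** One tent of base [a + b] is replaced by tents of bases [a] and [b]; the gain is the cross term
    [2 * a * b / 4]. *)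
Lemma gain_gap A p q y : 0 <= p -> q <= 1 -> gap A p q -> p < y < q ->
  gain A y = (y - p) * (q - y) / 2.
Proof.
move=> p0 q1 Apq pyq; have [pA qA pq _] := Apq; have /andP[py yq] := pyq.
have A0 : A != fset0 by apply/fset0Pn; exists p.
have B0 : (y |` A)%fset != fset0 by apply/fset0Pn; exists y; rewrite fset1U1.
have splitE B : B != fset0 -> avg_dist B =
    interval_dist B 0 p + interval_dist B p q + interval_dist B q 1.
  move=> B'0; rewrite -[avg_dist B]/(interval_dist B 0 1).
  by rewrite (@interval_distD _ 0 q)//; [rewrite (@interval_distD _ 0 p)//; lra|lra].
rewrite /gain !splitE// (interval_distU1_left _ pA (ltW py)).
rewrite (interval_distU1_right _ qA (ltW yq)) (interval_dist_gap Apq).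
rewrite (@interval_distD _ p y q)//; [|exact: ltW|exact: ltW].
rewrite (interval_dist_gap (gapU1l Apq pyq)) (interval_dist_gap (gapU1r Apq pyq)).
by field.
Qed.

Lemma gap_least A p y : is_least A p -> y < p -> gap (y |` A)%fset y p.
Proof.
move=> [pA Ap] yp; split => //; rewrite ?fset1U1 ?fset1Ur//.
by move=> x /fset1UP[->|/Ap->]; rewrite ?lexx ?orbT.
Qed.

Lemma gap_greatest A p y : is_greatest A p -> p < y -> gap (y |` A)%fset p y.
Proof.
move=> [pA Ap] yp; split => //; rewrite ?fset1U1 ?fset1Ur//.
by move=> x /fset1UP[->|/Ap->]; rewrite ?lexx ?orbT.
Qed.

Lemma is_leastU1 A p y : is_least A p -> y <= p -> is_least (y |` A)%fset y.
Proof.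
move=> [pA Ap] yp; split; first exact: fset1U1.
by move=> x /fset1UP[->//|/Ap]; exact: le_trans.
Qed.

Lemma is_greatestU1 A p y : is_greatest A p -> p <= y ->
  is_greatest (y |` A)%fset y.
Proof.
move=> [pA Ap] yp; split; first exact: fset1U1.
by move=> x /fset1UP[->//|/Ap] /le_trans; exact.
Qed.

(** The end interval contributes [p ^+ 2 / 2]; afterwards an end interval of length [y] and a gap of
    length [p - y] remain. As a quadratic in [y] the gain peaks at [p / 3]. *)
Lemma gain_least A p y : p <= 1 -> is_least A p -> 0 <= y < p ->
  gain A y = (p - y) * (p + 3 * y) / 4.
Proof.
move=> p1 Ap /andP[y0 yp]; have pA := Ap.1.
have A0 : A != fset0 by apply/fset0Pn; exists p.
have B0 : (y |` A)%fset != fset0 by apply/fset0Pn; exists y; rewrite fset1U1.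
rewrite /gain -[avg_dist A]/(interval_dist A 0 1) -[X in _ - X]/(interval_dist _ 0 1).
rewrite (@interval_distD A 0 p 1)//; [|lra].
rewrite (@interval_distD _ 0 p 1)//; [|lra].
rewrite (@interval_distD (y |` A)%fset 0 y p)//; [|lra].
rewrite (interval_distU1_right _ pA (ltW yp)) (interval_dist_gap (gap_least Ap yp)).
rewrite (interval_dist_least Ap); [|lra].
rewrite (interval_dist_least (is_leastU1 Ap (ltW yp)))//; by field.
Qed.

Lemma gain_greatest A p y : 0 <= p -> is_greatest A p -> p < y <= 1 ->
  gain A y = (y - p) * ((1 - p) + 3 * (1 - y)) / 4.
Proof.
move=> p0 Ap /andP[yp y1]; have pA := Ap.1.
have A0 : A != fset0 by apply/fset0Pn; exists p.
have B0 : (y |` A)%fset != fset0 by apply/fset0Pn; exists y; rewrite fset1U1.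
rewrite /gain -[avg_dist A]/(interval_dist A 0 1) -[X in _ - X]/(interval_dist _ 0 1).
rewrite (@interval_distD A 0 p 1)//; [|lra].
rewrite (@interval_distD _ 0 p 1)//; [|lra].
rewrite (@interval_distD (y |` A)%fset p y 1)//; [|lra].
rewrite (interval_distU1_left _ pA (ltW yp)) (interval_dist_gap (gap_greatest Ap yp)).
rewrite (interval_dist_greatest Ap); [|lra].
rewrite (interval_dist_greatest (is_greatestU1 Ap (ltW yp)))//; by field.
Qed.

Lemma avg_dist1 y : 0 <= y <= 1 ->
  avg_dist [fset y]%fset = (y ^+ 2 + (1 - y) ^+ 2) / 2.
Proof.
move=> /andP[y0 y1]; rewrite -[LHS]/(interval_dist _ 0 1).
have A0 : [fset y]%fset != fset0 by apply/fset0Pn; exists y; rewrite fset11.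
rewrite (@interval_distD _ 0 y)// interval_dist_least//; last first.
  by split=> [|x]; rewrite !inE// => /eqP->.
rewrite interval_dist_greatest//; first by field.
by split=> [|x]; rewrite !inE// => /eqP->.
Qed.

(** Diminishing returns, pointwise: adding [z] lowers a distance [d] by the positive part of
    [d - |x - z|], which is nondecreasing in [d], and adding [y] first can only lower [d]. *)
Lemma gain_mono A y z : A != fset0 -> gain (y |` A)%fset z <= gain A z.
Proof.
move=> A0; rewrite /gain.
have U0 (B : {fset R}) b : (b |` B)%fset != fset0.
  by apply/fset0Pn; exists b; rewrite fset1U1.
rewrite /avg_dist -!RintegralB//; [|exact: integrable_dist_set ..].
apply: le_Rintegral => //.
- have := integrableB _ (integrable_dist_set 0 1 (U0 A y))
    (integrable_dist_set 0 1 (U0 (y |` A)%fset z)).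
  exact.
- have := integrableB _ (integrable_dist_set 0 1 A0)
    (integrable_dist_set 0 1 (U0 A z)).
  exact.
move=> x _; rewrite !dist_setU1//.
move: (dist_set A x) `|x - y| `|x - z| => d a b.
by rewrite /Num.min; do ![case: ltP => ?]; lra.
Qed.

Lemma avg_dist_ge0 A : 0 <= avg_dist A.
Proof. by apply: Rintegral_ge0 => x _; exact: dist_set_ge0. Qed.

End dist.

(** * Optimal additions *)

Section greedy.
Context {R : realType}.
Implicit Types (A B : {fset R}) (x y z p q : R).

Lemma gap_succ A p b : p \in A -> b \in A -> p < b -> exists q, gap A p q.
Proof.
move=> pA bA pb; have : [fset x in A | p < x]%fset != fset0.
  by apply/fset0Pn; exists b; rewrite !inE/= bA.
move=> /(fset_argmin id)[q]; rewrite !inE/= => /andP[qA pq] qmin.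
exists q; split=> // x xA; have [//|px] := leP x p.
by apply: qmin; rewrite !inE/= xA.
Qed.

Lemma least_exists A : A != fset0 -> exists p, is_least A p.
Proof. by move=> /(fset_argmin id)[p]; exists p. Qed.

Lemma greatest_exists A : A != fset0 -> exists p, is_greatest A p.
Proof.
move=> /(fset_argmin -%R)[p pA pmin]; exists p; split=> // x /pmin.
by rewrite lerN2.
Qed.

Lemma gap_cases A y : A != fset0 -> y \notin A ->
  [\/ exists p q, gap A p q /\ p < y < q,
      exists2 p, is_least A p & y < p |
      exists2 p, is_greatest A p & p < y].
Proof.
move=> A0 yA; have [l Al] := least_exists A0; have [yl|ly] := ltP y l.
  by apply: Or32; exists l.
have [g Ag] := greatest_exists A0; have [gy|yg] := ltP g y.
  by apply: Or33; exists g.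
apply: Or31; have : [fset x in A | x <= y]%fset != fset0.
  by apply/fset0Pn; exists l; rewrite !inE/= Al.1.
move=> /greatest_exists[p []]; rewrite !inE/= => /andP[pA py] pmax.
have pny z : z \in A -> z <= y -> z < y.
  by move=> zA; rewrite le_eqVlt => /predU1P[zy|//]; rewrite -zy zA in yA.
have pg : p < g by apply: lt_le_trans yg; exact: pny.
have [q Apq] := gap_succ pA Ag.1 pg; exists p, q; split=> //.
rewrite pny//=; have [_ qA pq _] := Apq; rewrite ltNge; apply/negP => qy.
by have := pmax q; rewrite !inE/= qA qy leNgt pq => /(_ erefl).
Qed.

(** The comparison may run over all of [0, 1] because points of [A] have gain zero. *)
Definition best_addition A y := [/\ y \notin A, 0 <= y <= 1, 0 < gain A y &
  forall z, 0 <= z <= 1 -> gain A z <= gain A y].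

Definition in_unit A := {in A, forall x, 0 <= x <= 1}.

Lemma gain_pos A : A != fset0 -> in_unit A ->
  exists y, [/\ 0 <= y <= 1, y \notin A & 0 < gain A y].
Proof.
move=> A0 A01; suff [y y01 y0] : exists2 y, 0 <= y <= 1 & 0 < gain A y.
  exists y; split=> //; apply: contraL y0 => yA.
  by rewrite /gain mem_fset1U// subrr ltxx.
(* Either some end interval is nondegenerate and can be cut, or [0] and [1] both belong to [A] and
   the first gap can be bisected. *)
have [l Al] := least_exists A0; have [g Ag] := greatest_exists A0.
have /andP[l0 l1] := A01 _ Al.1; have /andP[g0 g1] := A01 _ Ag.1.
move: l0; rewrite le_eqVlt => /predU1P[l0|l0]; last first.
  by exists (l / 3); [lra|rewrite (gain_least l1 Al); nra].
move: g1; rewrite le_eqVlt => /predU1P[g1|g1]; last first.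
  by exists (1 - (1 - g) / 3); [lra|rewrite (gain_greatest g0 Ag); nra].
have lg : l < g by rewrite g1 -l0.
have [q Alq] := gap_succ Al.1 Ag.1 lg; have [_ qA lq _] := Alq.
have /andP[q0 q1] := A01 _ qA.
exists ((l + q) / 2); first lra.
by rewrite (gain_gap _ q1 Alq); nra.
Qed.

Lemma best_gap A y p q : in_unit A -> best_addition A y -> gap A p q ->
  (q - p) ^+ 2 / 8 <= gain A y.
Proof.
move=> A01 [_ _ _ ymax] Apq; have [pA qA pq _] := Apq.
have /andP[p0 p1] := A01 _ pA; have /andP[q0 q1] := A01 _ qA.
apply: le_trans (ymax ((p + q) / 2) _); last lra.
by rewrite (gain_gap _ _ Apq)//; [nra|lra].
Qed.

Lemma best_least A y p : in_unit A -> best_addition A y -> is_least A p ->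
  p ^+ 2 / 3 <= gain A y.
Proof.
move=> A01 [_ _ y0 ymax] Ap; have /andP[p0 p1] := A01 _ Ap.1.
move: p0; rewrite le_eqVlt => /predU1P[<-|p0].
  by rewrite expr0n/= mul0r ltW.
apply: le_trans (ymax (p / 3) _); last lra.
by rewrite (gain_least p1 Ap); nra.
Qed.

Lemma best_greatest A y p : in_unit A -> best_addition A y ->
  is_greatest A p -> (1 - p) ^+ 2 / 3 <= gain A y.
Proof.
move=> A01 [_ _ y0 ymax] Ap; have /andP[p0 p1] := A01 _ Ap.1.
move: p1; rewrite le_eqVlt => /predU1P[->|p1].
  by rewrite subrr expr0n/= mul0r ltW.
apply: le_trans (ymax (1 - (1 - p) / 3) _); last lra.
by rewrite (gain_greatest p0 Ap); nra.
Qed.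

Lemma eq_of_sqr_le0 x y : (x - y) ^+ 2 <= 0 -> x = y.
Proof.
by move=> h; apply/eqP; rewrite -subr_eq0 -sqrf_eq0 eq_le h sqr_ge0.
Qed.

(** On every interval the gain is a concave quadratic in [y]. Its vertex value minus its value at
    [y] is a positive multiple of a square, so maximality forces [y] to be the vertex. *)
Lemma best_cases A y : A != fset0 -> in_unit A -> best_addition A y ->
  [\/ exists p q, [/\ gap A p q, y = (p + q) / 2 & gain A y = (q - p) ^+ 2 / 8],
      exists p, [/\ is_least A p, 0 < p, y = p / 3 & gain A y = p ^+ 2 / 3] |
      exists p, [/\ is_greatest A p, p < 1, y = 1 - (1 - p) / 3 &
        gain A y = (1 - p) ^+ 2 / 3]].
Proof.
move=> A0 A01 Ay; have [yA /andP[y0 y1] _ _] := Ay.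
have [[p [q [Apq pyq]]]|[p Ap yp]|[p Ap yp]] := gap_cases A0 yA.
- apply: Or31; exists p, q; have [pA qA pq _] := Apq.
  have /andP[p0 p1] := A01 _ pA; have /andP[q0 q1] := A01 _ qA.
  have := best_gap A01 Ay Apq; rewrite (gain_gap _ _ Apq)// => le.
  suff -> : y = (p + q) / 2 by split=> //; field.
  by apply: eq_of_sqr_le0; lra.
- have /andP[p0 p1] := A01 _ Ap.1.
  apply: Or32; exists p; have := best_least A01 Ay Ap.
  rewrite (gain_least _ Ap) ?y0// => le.
  suff -> : y = p / 3 by split=> //; [lra|field].
  by apply: eq_of_sqr_le0; lra.
- have /andP[p0 p1] := A01 _ Ap.1.
  apply: Or33; exists p; have := best_greatest A01 Ay Ap.
  rewrite (gain_greatest _ Ap) ?y1 ?andbT// => le.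
  suff -> : y = 1 - (1 - p) / 3 by split=> //; [lra|field].
  by apply: eq_of_sqr_le0; lra.
Qed.

(** For a single point [y] in [0, 1], [F] equals [(y - 1/2)^2 + 1/4]. *)
Lemma solution1 (S : nat -> {fset R}) : short_term_solutions S ->
  S 1%N = [fset (1 / 2 : R)]%fset.
Proof.
move=> [S0 SP]; have [[SN0 _ S01 cS] Smin] := SP 0%N.
have /cardfs1P[a Sa] : #|` S 1%N| == 1%N.
  by rewrite eqn_leq cS/= cardfs_gt0.
have /andP[a0 a1] : 0 <= a <= 1.
  by have := S01 a; rewrite Sa inE eqxx in_itv/=; apply.
have := Smin [fset (1 / 2 : R)]%fset.
rewrite Sa avg_dist1 ?a0 ?a1// avg_dist1; last lra.
have adm : admissible (S 0%N) 1 [fset (1 / 2 : R)]%fset.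
  split; rewrite ?S0 ?fsub0set ?cardfs1//.
    by apply/fset0Pn; exists (1 / 2); rewrite fset11.
  by move=> x; rewrite inE in_itv/= => /eqP->; lra.
move=> /(_ adm) le; congr ([fset _]%fset); apply: eq_of_sqr_le0; lra.
Qed.

(** A point of positive gain always exists, so the minimizer strictly lowers [F] and must contain a
    new point; the cardinality bound allows only one. *)
Lemma solution_step (S : nat -> {fset R}) n : short_term_solutions S ->
  [/\ #|` S n.+1| = n.+1, in_unit (S n.+1) &
   exists2 y, best_addition (S n.+1) y & S n.+2 = (y |` S n.+1)%fset].
Proof.
move=> Ssol; have [S0 SP] := Ssol.
have Sne k : S k.+1 != fset0 by have [[]] := SP k.
have Sin k : in_unit (S k.+1).
  have [[_ _ S01 _] _] := SP k; by move=> x /S01; rewrite in_itv.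
(* The exact cardinality is assumed here and supplied by the induction that proves [ck]. *)
have cardS k : #|` S k.+1| = k.+1 ->
  exists2 y, best_addition (S k.+1) y & S k.+2 = (y |` S k.+1)%fset.
  move=> ck; have adm z : 0 <= z <= 1 -> z \notin S k.+1 ->
      admissible (S k.+1) k.+2 (z |` S k.+1)%fset.
    move=> z01 zS; split; rewrite ?fsubsetU1//.
    - by apply/fset0Pn; exists z; rewrite fset1U1.
    - by move=> x /fset1UP[->|/Sin]; rewrite in_itv.
    - by rewrite cardfsU1 zS ck.
  have [[_ sub _ le] Smin] := SP k.+1.
  have [z [z01 zS gz]] := gain_pos (Sne k) (@Sin k).
  have lt : avg_dist (S k.+2) < avg_dist (S k.+1).
    apply: le_lt_trans (Smin _ (adm _ z01 zS)) _.
    by rewrite -subr_gt0.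
  have : ~~ (S k.+2 `<=` S k.+1)%fset.
    apply: contraL lt => sub'; have -> : S k.+2 = S k.+1.
      by apply/eqP; rewrite eqEfsubset sub sub'.
    by rewrite ltxx.
  move=> /fsubsetPn[y yS yS'].
  have E : S k.+2 = (y |` S k.+1)%fset.
    apply/esym/eqP; rewrite eqEfcard; apply/andP; split.
      by rewrite fsubUset sub andbT fsub1set.
    by rewrite cardfsU1 yS' ck.
  exists y; last exact: E.
  split; [exact: yS'|exact: (Sin k.+1 y yS)|by rewrite /gain -E subr_gt0|].
  move=> x x01; rewrite /gain -E; have [xS|xS] := boolP (x \in S k.+1).
    rewrite (mem_fset1U xS) subrr subr_ge0; exact: ltW.
  rewrite lerD2l lerN2; apply: Smin; exact: adm.
have ck : #|` S n.+1| = n.+1.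
  elim: n => [|n IH]; first by rewrite (solution1 Ssol) cardfs1.
  by have [y [yS _ _ _] ->] := cardS _ IH; rewrite cardfsU1 yS IH.
by split=> //; exact: cardS.
Qed.

End greedy.

(** * Intervals outside [1/6, 5/6] *)

Section grid.
Context {R : realType}.
Implicit Types (A B : {fset R}) (x y z p q : R).

Lemma gapU1_inv A y p q : gap (y |` A)%fset p q ->
  [\/ gap A p q, p \in A /\ q = y | p = y /\ q \in A].
Proof.
move=> [pA qA pq pAq]; have pAq' : {in A, forall x, (x <= p) || (q <= x)}.
  by move=> x xA; apply: pAq; rewrite fset1Ur.
case/fset1UP: pA => [py|pA]; case/fset1UP: qA => [qy|qA].
- by move: pq; rewrite py qy ltxx.
- exact: Or33.
- exact: Or32.
- exact: Or31.
Qed.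

Lemma gapU1_gap A p' q' y p q : gap A p' q' -> p' < y < q' ->
  gap (y |` A)%fset p q ->
  [\/ gap A p q, p = p' /\ q = y | p = y /\ q = q'].
Proof.
move=> [pA' qA' _ Ap'q'] /andP[py' yq'] Bpq; have [_ _ pq pBq] := Bpq.
have pBq' x : x \in A -> (x <= p) || (q <= x).
  by move=> xA; apply: pBq; rewrite fset1Ur.
have [|[pA qy]|[py qA]] := gapU1_inv Bpq; first exact: Or31.
  apply: Or32; split=> //; apply/eqP; rewrite eq_le.
  have := Ap'q' p pA; have := pBq' p' pA'; rewrite qy in pq *; lra.
apply: Or33; split=> //; apply/eqP; rewrite eq_le.
have := Ap'q' q qA; have := pBq' q' qA'; rewrite py in pq *; lra.
Qed.

Lemma gapU1_least A l y p q : is_least A l -> y < l -> gap (y |` A)%fset p q ->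
  gap A p q \/ p = y /\ q = l.
Proof.
move=> [lA Al] yl Bpq; have [_ _ pq pBq] := Bpq.
have [|[pA qy]|[py qA]] := gapU1_inv Bpq; first by left.
  by have := Al _ pA; lra.
right; split=> //; apply/eqP; rewrite eq_le Al// andbT.
by have := pBq l; rewrite fset1Ur// => /(_ isT); lra.
Qed.

Lemma gapU1_greatest A g y p q : is_greatest A g -> g < y ->
  gap (y |` A)%fset p q -> gap A p q \/ p = g /\ q = y.
Proof.
move=> [gA Ag] gy Bpq; have [_ _ pq pBq] := Bpq.
have [|[pA qy]|[py qA]] := gapU1_inv Bpq; first by left.
  right; split=> //; apply/eqP; rewrite eq_le Ag//=.
  by have := pBq g; rewrite fset1Ur// => /(_ isT); lra.
by have := Ag _ qA; lra.
Qed.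

(** Arithmetic invariant of the region outside [1/6, 5/6]: the factors 6 and 9 in the denominators
    are what excludes ties with the gains of the dyadic grids. *)
Definition outer_state A := [/\ 1 / 6 \in A /\ 5 / 6 \in A,
  exists2 l, is_least A l & exists d : nat, l = 1 / (6 * d.+1%:R),
  exists2 g, is_greatest A g & exists d : nat, 1 - g = 1 / (6 * d.+1%:R) &
  forall p q, gap A p q -> q <= 1 / 6 \/ 5 / 6 <= p ->
    exists c : nat, q - p = 1 / (9 * c.+1%:R)].

Lemma is_least_uniq A p p' : is_least A p -> is_least A p' -> p = p'.
Proof. by move=> [pA Ap] [pA' Ap']; apply/eqP; rewrite eq_le Ap// Ap'. Qed.

Lemma is_greatest_uniq A p p' : is_greatest A p -> is_greatest A p' -> p = p'.
Proof. by move=> [pA Ap] [pA' Ap']; apply/eqP; rewrite eq_le Ap// Ap'. Qed.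

Lemma is_leastU1_ge A l y : is_least A l -> l <= y -> is_least (y |` A)%fset l.
Proof.
move=> [lA Al] ly; split=> [|x /fset1UP[->//|/Al//]]; exact: fset1Ur.
Qed.

Lemma is_greatestU1_le A g y : is_greatest A g -> y <= g ->
  is_greatest (y |` A)%fset g.
Proof.
move=> [gA Ag] yg; split=> [|x /fset1UP[->//|/Ag//]]; exact: fset1Ur.
Qed.

Lemma S_neq0 (k : nat) : k.+1%:R != 0 :> R.
Proof. by rewrite pnatr_eq0. Qed.

(** Bisecting an outer gap [1/(9c)] doubles [c]. Cutting an end interval [1/(6d)] at one third
    leaves the end interval [1/(18d)] and creates the outer gap [1/(9d)]. A bisection inside
    [1/6, 5/6] creates no outer gap. *)
Lemma outer_stateU1 A y : in_unit A -> best_addition A y -> outer_state A ->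
  outer_state (y |` A)%fset.
Proof.
move=> A01 Ay [[A6 A56] [l Al [d dl]] [g Ag [e eg]] Agap].
have A0 : A != fset0 by apply/fset0Pn; exists (1 / 6).
have d6 := Al.2 _ A6; have e6 := Ag.2 _ A56.
have [[p' [q' [Apq' yE _]]]|[l' [Al' l0 yE _]]|[g' [Ag' g1 yE _]]] :=
  best_cases A0 A01 Ay.
- have [pA' qA' pq' pAq'] := Apq'; have pyq' : p' < y < q' by rewrite yE; lra.
  have l1 := Al.2 _ pA'; have g1 := Ag.2 _ qA'.
  split; first by rewrite !fset1Ur.
  + by exists l; [apply: is_leastU1_ge => //; lra|exists d].
  + by exists g; [apply: is_greatestU1_le => //; lra|exists e].
  move=> p q Bpq out; have := pAq' _ A6; have := pAq' _ A56.
  have half : q' <= 1 / 6 \/ 5 / 6 <= p' -> q - p = (q' - p') / 2 ->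
      exists c : nat, q - p = 1 / (9 * c.+1%:R).
    move=> /(Agap _ _ Apq')[c c9] ->; exists (c.*2.+1); rewrite c9.
    have -> : (c.*2.+1).+1%:R = 2 * c.+1%:R :> R.
      by rewrite -doubleS -mul2n natrM.
    by move: c.+1%:R (S_neq0 c) => z z0; field.
  have [Apq|[? ?]|[? ?]] := gapU1_gap Apq' pyq' Bpq; first by move=> _ _; exact: Agap.
    by subst p q => h1 h2; apply: half; [lra|rewrite yE; field].
  by subst p q => h1 h2; apply: half; [lra|rewrite yE; field].
- have E := is_least_uniq Al' Al; split; first by rewrite !fset1Ur.
  + exists y; first by apply: (is_leastU1 Al); lra.
    exists ((3 * d).+2); have -> : ((3 * d).+2).+1%:R = 3 * d.+1%:R :> R.
      by rewrite -(natrM R 3 d.+1); congr (_%:R); lia.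
    by rewrite yE E dl; move: d.+1%:R (S_neq0 d) => z z0; field.
  + by exists g; [apply: is_greatestU1_le => //; lra|exists e].
  move=> p q Bpq out; have yl : y < l by lra.
  have [Apq|[? ?]] := gapU1_least Al yl Bpq; first exact: Agap.
  by exists d; subst p q; rewrite yE E dl; move: d.+1%:R (S_neq0 d) => z z0; field.
- have E := is_greatest_uniq Ag' Ag; split; first by rewrite !fset1Ur.
  + by exists l; [apply: is_leastU1_ge => //; lra|exists d].
  + exists y; first by apply: (is_greatestU1 Ag); lra.
    exists ((3 * e).+2); have -> : ((3 * e).+2).+1%:R = 3 * e.+1%:R :> R.
      by rewrite -(natrM R 3 e.+1); congr (_%:R); lia.
    rewrite yE E (_ : 1 - (1 - _) = (1 - g) / 3); last by ring.
    by rewrite eg; move: e.+1%:R (S_neq0 e) => z z0; field.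
  move=> p q Bpq out; have yl : g < y by lra.
  have [Apq|[? ?]] := gapU1_greatest Ag yl Bpq; first exact: Agap.
  exists e; subst p q; rewrite yE E (_ : _ - g = (1 - g) * 2 / 3); last by field.
  by rewrite eg; move: e.+1%:R (S_neq0 e) => z z0; field.
Qed.

(* The gain of halving an interval of length [1 / (3 * 2 ^ m)]. *)
Definition level_gain m : R := 1 / (72 * 4 ^+ m).

(** Clearing denominators, equality would read [3 * k.+1 ^ 2 = 2 * 4 ^ m], whose right side is prime
    to 3. *)
Lemma end_gain_neq (k m : nat) : (1 / (6 * k.+1%:R)) ^+ 2 / 3 != level_gain m.
Proof.
apply/eqP; rewrite /level_gain => E.
have E3 : (3 * (k.+1 * k.+1) = 2 * 4 ^ m)%N.
  apply/eqP; rewrite -(eqr_nat R) !natrM natrX; apply/eqP.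
  have m0 : 4 ^+ m != 0 :> R by rewrite expf_neq0// pnatr_eq0.
  have k0 : k.+1%:R != 0 :> R by rewrite pnatr_eq0.
  move: (k.+1%:R) (4%:R ^+ m) k0 m0 E => a b a0 b0 E.
  have := congr1 (fun z => z * (216 * a ^+ 2 * b)) E.
  have -> : (1 / (6 * a)) ^+ 2 / 3 * (216 * a ^+ 2 * b) = 2 * b by field; rewrite a0.
  have -> : 1 / (72 * b) * (216 * a ^+ 2 * b) = 3 * (a * a) by field; rewrite b0.
  by [].
have := congr1 (dvdn 3) E3; rewrite dvdn_mulr// => /esym.
by rewrite Euclid_dvdM// Euclid_dvdX.
Qed.

(** Here equality would read [9 * k.+1 ^ 2 = 4 ^ m], again impossible modulo 3. *)
Lemma outer_gain_neq (k m : nat) : (1 / (9 * k.+1%:R)) ^+ 2 / 8 != level_gain m.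
Proof.
apply/eqP; rewrite /level_gain => E.
have E3 : (9 * (k.+1 * k.+1) = 4 ^ m)%N.
  apply/eqP; rewrite -(eqr_nat R) !natrM natrX; apply/eqP.
  have m0 : 4 ^+ m != 0 :> R by rewrite expf_neq0// pnatr_eq0.
  have k0 : k.+1%:R != 0 :> R by rewrite pnatr_eq0.
  move: (k.+1%:R) (4%:R ^+ m) k0 m0 E => a b a0 b0 E.
  have := congr1 (fun z => z * (648 * a ^+ 2 * b)) E.
  have -> : (1 / (9 * a)) ^+ 2 / 8 * (648 * a ^+ 2 * b) = b by field; rewrite a0.
  have -> : 1 / (72 * b) * (648 * a ^+ 2 * b) = 9 * (a * a) by field; rewrite b0.
  by [].
have := congr1 (dvdn 3) E3; rewrite dvdn_mulr// => /esym.
by rewrite Euclid_dvdX.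
Qed.

(* The numbers [1 / (9 * c)] and [1 / (6 * d)] are never commensurate with
   [1 / (3 * 2 ^ m)] in the way a tie of gains would require: this is a
   divisibility by 3. *)
Lemma best_outer A y : in_unit A -> best_addition A y -> outer_state A ->
  (~~ (1 / 6 <= y <= 5 / 6) /\ forall m, gain A y != level_gain m) \/
  exists p q, [/\ gap A p q, 1 / 6 <= p, q <= 5 / 6, y = (p + q) / 2 &
    gain A y = (q - p) ^+ 2 / 8].
Proof.
move=> A01 Ay [[A6 A56] [l Al [d dl]] [g Ag [e eg]] Agap].
have A0 : A != fset0 by apply/fset0Pn; exists (1 / 6).
have d6 := Al.2 _ A6; have e6 := Ag.2 _ A56.
have [[p [q [Apq yE gE]]]|[l' [Al' l0 yE gE]]|[g' [Ag' g1 yE gE]]] :=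
  best_cases A0 A01 Ay.
- have [pA qA pq pAq] := Apq; have := pAq _ A6; have := pAq _ A56.
  have [out|ins] := boolP ((q <= 1 / 6) || (5 / 6 <= p)).
    move=> _ _; left; split; first by rewrite yE; lra.
    move=> m; rewrite gE; have [c ->] := Agap p q Apq (orP out).
    exact: outer_gain_neq.
  by move=> h1 h2; right; exists p, q; split=> //; lra.
- left; rewrite gE (is_least_uniq Al' Al); split.
    by rewrite yE (is_least_uniq Al' Al); lra.
  by rewrite dl => m; exact: end_gain_neq.
- left; rewrite gE (is_greatest_uniq Ag' Ag); split.
    by rewrite yE (is_greatest_uniq Ag' Ag); lra.
  by rewrite eg => m; exact: end_gain_neq.
Qed.

End grid.

(** * Dyadic grids of [1/6, 5/6] *)

Section phases.
Context {R : realType}.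
Implicit Types (A B : {fset R}) (x y z p q : R).

(** Since [1/6, 5/6] has length 2/3, it splits into exactly [2 ^ m.+1] cells of this length. *)
Definition mesh m : R := 1 / (3 * 2 ^+ m).

Definition grid_point m k : R := 1 / 6 + k%:R * mesh m.

Definition grid m : {fset R} :=
  [fset x in [seq grid_point m k | k <- iota 0 (2 ^ m.+1).+1]]%fset.

Lemma mesh_gt0 m : 0 < mesh m.
Proof. by rewrite divr_gt0// mulr_gt0// exprn_gt0. Qed.

Lemma meshS m : mesh m = 2 * mesh m.+1.
Proof.
rewrite /mesh exprS; have : 2 ^+ m != 0 :> R by rewrite expf_neq0.
by move: (2 ^+ m) => a a0; field.
Qed.

Lemma mesh_total m : (2 ^ m.+1)%:R * mesh m = 2 / 3.
Proof.
rewrite natrX /mesh exprS; have : 2 ^+ m != 0 :> R by rewrite expf_neq0.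
by move: (2 ^+ m) => a a0; field.
Qed.

Lemma mesh_gain m : mesh m ^+ 2 / 8 = level_gain m.
Proof.
have -> : level_gain m = 1 / (72 * (2 ^+ m) ^+ 2) :> R.
  by rewrite /level_gain exprAC (_ : 2 ^+ 2 = 4 :> R)//; ring.
rewrite /mesh.
have : 2 ^+ m != 0 :> R by rewrite expf_neq0.
by move: (2 ^+ m) => a a0; field.
Qed.

Lemma level_gainS m : level_gain m.+1 < level_gain m :> R.
Proof.
by rewrite -!mesh_gain (meshS m); have := mesh_gt0 m.+1; nra.
Qed.

Lemma grid_pointS m k : grid_point m k = grid_point m.+1 k.*2.
Proof. by rewrite /grid_point meshS mulrA -natrM muln2. Qed.

Lemma grid_point_lt m k l : (grid_point m k < grid_point m l) = (k < l)%N.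
Proof. by rewrite ltrD2l ltr_pM2r ?mesh_gt0// ltr_nat. Qed.

Lemma grid_point_le m k l : (grid_point m k <= grid_point m l) = (k <= l)%N.
Proof. by rewrite lerD2l ler_pM2r ?mesh_gt0// ler_nat. Qed.

Lemma gridP m x :
  reflect (exists2 k, (k <= 2 ^ m.+1)%N & x = grid_point m k) (x \in grid m).
Proof.
rewrite /grid in_fset; apply: (iffP mapP) => -[k kn ->]; exists k => //.
  by move: kn; rewrite mem_iota ltnS.
by rewrite mem_iota ltnS.
Qed.

Lemma grid_point_last m : grid_point m (2 ^ m.+1) = 5 / 6.
Proof. by rewrite /grid_point mesh_total; field. Qed.

Lemma grid_point0 m : grid_point m 0 = 1 / 6.
Proof. by rewrite /grid_point mul0r addr0. Qed.

Lemma grid_bounds m x : x \in grid m -> 1 / 6 <= x <= 5 / 6.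
Proof.
move=> /gridP[k kn ->]; rewrite -(grid_point0 m) -(grid_point_last m).
by rewrite !grid_point_le.
Qed.

Lemma card_grid m : #|` grid m| = (2 ^ m.+1).+1.
Proof.
rewrite card_fseq undup_id ?size_map ?size_iota//.
rewrite map_inj_uniq ?iota_uniq// => k l kl.
by apply/eqP; rewrite eqn_leq -!(grid_point_le m) kl lexx.
Qed.

Lemma grid_sub m : (grid m `<=` grid m.+1)%fset.
Proof.
apply/fsubsetP => x /gridP[k kn ->]; apply/gridP; exists k.*2.
  by rewrite expnS mul2n leq_double.
exact: grid_pointS.
Qed.

Definition middle A : {fset R} := [fset x in A | 1 / 6 <= x <= 5 / 6]%fset.

Lemma in_middle A x : (x \in middle A) = (x \in A) && (1 / 6 <= x <= 5 / 6).
Proof. by rewrite !inE. Qed.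

Lemma middleU1_out A y : ~~ (1 / 6 <= y <= 5 / 6) ->
  middle (y |` A)%fset = middle A.
Proof.
move=> yout; apply/fsetP => x; rewrite !in_middle in_fset1U.
by have [->|//] := eqVneq x y; rewrite (negbTE yout) !andbF.
Qed.

Lemma middleU1_in A y : 1 / 6 <= y <= 5 / 6 ->
  middle (y |` A)%fset = (y |` middle A)%fset.
Proof.
move=> yin; apply/fsetP => x; rewrite in_fset1U !in_middle in_fset1U.
by have [->|//] := eqVneq x y; rewrite yin.
Qed.

(** A longer gap would contain the grid point following [p] in its interior. *)
Lemma grid_gap A m p q : (grid m `<=` A)%fset -> gap A p q ->
  p \in grid m -> q \in grid m -> q - p = mesh m.
Proof.
move=> /fsubsetP gA [_ _ pq pAq] /gridP[k kn pE] /gridP[l ln qE].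
subst p q; move: pq; rewrite grid_point_lt => kl.
have : grid_point m k.+1 \in A.
  by apply: gA; apply/gridP; exists k.+1 => //; exact: leq_trans kl ln.
move=> /pAq; rewrite !grid_point_le ltnn/= => lk.
have -> : l = k.+1 by apply/eqP; rewrite eqn_leq lk kl.
by rewrite /grid_point -natr1; ring.
Qed.

(* Between two consecutive coarse grid points only one fine one is missing. *)
Lemma middle_gap A m p q : (grid m `<=` A)%fset ->
  (middle A `<=` grid m.+1)%fset -> gap A p q -> 1 / 6 <= p -> q <= 5 / 6 ->
  q - p = mesh m.+1 \/ q - p = mesh m /\ (p + q) / 2 \in grid m.+1.
Proof.
move=> /fsubsetP gA /fsubsetP mA [pA qA pq pAq] p1 q5.
have /gridP[k kn pE] : p \in grid m.+1 by apply: mA; rewrite in_middle pA; lra.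
have /gridP[l ln qE] : q \in grid m.+1 by apply: mA; rewrite in_middle qA; lra.
subst p q; move: pq; rewrite grid_point_lt => kl.
have half j : (j <= 2 ^ m.+1)%N -> (j.*2 <= k)%N || (l <= j.*2)%N.
  move=> jn; rewrite -!(grid_point_le m.+1) -grid_pointS; apply: pAq.
  by apply: gA; apply/gridP; exists j.
have kn2 : (k < 2 ^ m.+2)%N by exact: leq_trans kl ln.
have [->|->] : l = k.+1 \/ l = k.+2.
- have := half (k./2.+1); rewrite expnS in kn2; have := odd_double_half k.
  by case: (odd k); lia.
- by left; rewrite /grid_point -natr1; ring.
- right; split; first by rewrite /grid_point (meshS m) -natr1 -natr1; ring.
  apply/gridP; exists k.+1 => //; by rewrite /grid_point -natr1 -natr1; field.
Qed.

(** By counting, some point of the finer grid is missing. Coarse points are present, so its index is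
    odd and it is the midpoint of a coarse cell; no other point of the finer grid lies inside that
    cell, which is therefore a gap. *)
Lemma unfilled_gap A m : (grid m `<=` A)%fset ->
  (middle A `<=` grid m.+1)%fset -> (#|` middle A| < #|` grid m.+1|)%N ->
  exists p q, gap A p q /\ q - p = mesh m.
Proof.
move=> gA mA card; have /fsubsetPn[x xg xA] : ~~ (grid m.+1 `<=` middle A)%fset.
  by apply/negP => /fsubset_leq_card; rewrite leqNgt card.
have {}xA : x \notin A.
  by apply: contra xA => xA; rewrite in_middle xA (grid_bounds xg).
have /gridP[k kn xE] := xg; have := odd_double_half k.
have [|_] := boolP (odd k); last first.
  rewrite add0n => kE; move: xA; rewrite xE -kE -grid_pointS => /negP[].
  apply: (fsubsetP gA); apply/gridP; exists k./2 => //.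
  by rewrite expnS in kn; lia.
rewrite add1n; set j := k./2 => oddk kE.
have jn : (j < 2 ^ m.+1)%N by rewrite expnS in kn; lia.
exists (grid_point m j), (grid_point m j.+1); split; last first.
  by rewrite /grid_point -natr1; ring.
split; rewrite ?grid_point_lt//.
- by apply: (fsubsetP gA); apply/gridP; exists j => //; exact: ltnW.
- by apply: (fsubsetP gA); apply/gridP; exists j.+1.
move=> z zA; have [//|jz] := leP z (grid_point m j).
have [//|zj] := leP (grid_point m j.+1) z.
have /gridP[l ln zE] : z \in grid m.+1.
  apply: (fsubsetP mA); rewrite in_middle zA.
  have j1 := grid_point_le m 0 j; have j2 := grid_point_le m j.+1 (2 ^ m.+1).
  move: j1 j2; rewrite grid_point0 grid_point_last jn leq0n; lra.
move: jz zj; rewrite zE !(grid_pointS m) !grid_point_lt => jl lj.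
have lk : l = k by lia.
by move: xA; rewrite xE -lk -zE zA.
Qed.

End phases.

(** * Phases of a solution *)

Section solutions.
Context {R : realType} (S : nat -> {fset R}).
Context (Ssol : short_term_solutions S).
Implicit Types (x y z p q : R).

(** The default [0] is taken only where no suitable point exists, which [addedP] excludes for
    [0 < n]. *)
Definition added n : R :=
  xget 0 [set y | best_addition (S n) y /\ S n.+1 = (y |` S n)%fset].

Lemma addedP n : (0 < n)%N ->
  best_addition (S n) (added n) /\ S n.+1 = (added n |` S n)%fset.
Proof.
case: n => // n _; have [_ _ [y yb yS]] := solution_step n Ssol.
by have := @xgetPex _ 0 [set y | best_addition (S n.+1) y /\
  S n.+2 = (y |` S n.+1)%fset]; apply; exists y.
Qed.

Lemma card_solution n : #|` S n| = n.
Proof.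
case: n => [|n]; first by rewrite Ssol.1 cardfs0.
by have [-> _ _] := solution_step n Ssol.
Qed.

Lemma solution_in_unit n : in_unit (S n).
Proof.
case: n => [|n]; first by rewrite Ssol.1 => x; rewrite inE.
by have [_ + _] := solution_step n Ssol.
Qed.

Lemma solution_neq0 n : (0 < n)%N -> S n != fset0.
Proof. by move=> n0; rewrite -cardfs_gt0 card_solution. Qed.

Definition decrease n := avg_dist (S n) - avg_dist (S n.+1).

Lemma decreaseE n : (0 < n)%N -> decrease n = gain (S n) (added n).
Proof. by move=> n0; rewrite /decrease /gain -(addedP n0).2. Qed.

Lemma decrease_gt0 n : (0 < n)%N -> 0 < decrease n.
Proof. by move=> n0; rewrite decreaseE//; have [[]] := addedP n0. Qed.

(** By diminishing returns the later point would have gained at least as much one step earlier, when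
    the point actually added was the best one. *)
Lemma decreaseS n : (0 < n)%N -> decrease n.+1 <= decrease n.
Proof.
move=> n0; rewrite !decreaseE//; have [[_ _ _ amax] Sn] := addedP n0.
have [[_ a01 _ _] _] := addedP (ltn0Sn n).
rewrite {1}Sn; apply: le_trans (amax _ a01).
by apply: gain_mono; exact: solution_neq0.
Qed.

Lemma decrease_le m n : (0 < m <= n)%N -> decrease n <= decrease m.
Proof.
move=> /andP[m0]; elim: n => [|n IH]; first by rewrite leqNgt m0.
rewrite leq_eqVlt => /predU1P[->//|mn]; apply: le_trans (IH mn).
by apply: decreaseS; exact: leq_trans m0 mn.
Qed.

Lemma decrease_gap n p q : gap (S n) p q -> (q - p) ^+ 2 / 8 <= decrease n.
Proof.
move=> gpq; have n0 : (0 < n)%N.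
  by rewrite -(card_solution n) cardfs_gt0; apply/fset0Pn; exists p; have [] := gpq.
rewrite decreaseE//; apply: best_gap gpq; first exact: solution_in_unit.
by have [] := addedP n0.
Qed.

Definition filling_state m n := [/\ outer_state (S n), (grid m `<=` S n)%fset &
  (middle (S n) `<=` grid m.+1)%fset].

(** An unfilled coarse cell offers the gain [level_gain m], so the upper bound on [decrease n] is
    attained. Outer additions never have exactly this gain and cells of the finer grid offer less,
    so a coarse cell is bisected. *)
Lemma filling_step m n : (0 < n)%N -> filling_state m n ->
  (#|` middle (S n)| < #|` @grid R m.+1|)%N -> decrease n <= level_gain m ->
  [/\ decrease n = level_gain m, filling_state m n.+1,
      1 / 6 <= added n <= 5 / 6 & #|` middle (S n.+1)| = #|` middle (S n)|.+1].
Proof.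
move=> n0 [out gS mS] card le; have [p [q [gpq pq]]] := unfilled_gap gS mS card.
have dE : decrease n = level_gain m.
  by apply/eqP; rewrite eq_le le -mesh_gain -pq; exact: decrease_gap.
have S01 := @solution_in_unit n; have [best SE] := addedP n0.
have [[_]|[p' [q' [gpq' p1 q5 aE gE]]]] := best_outer S01 best out.
  by move/(_ m)/eqP; rewrite -decreaseE.
have [q'p'|[q'p' ag]] := middle_gap gS mS gpq' p1 q5.
  by have := @level_gainS R m; rewrite -dE decreaseE// gE q'p' mesh_gain ltxx.
rewrite -aE in ag; have ain := grid_bounds ag.
split=> //.
  split; rewrite SE.
  - exact: outer_stateU1.
  - exact: fsubset_trans gS (fsubsetU1 _ _).
  - by rewrite middleU1_in// fsubUset fsub1set ag.
rewrite SE middleU1_in// cardfsU1 in_middle.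
by have [/negbTE-> _ _ _] := best.
Qed.

Definition phase_start m n := [/\ (2 < n)%N, outer_state (S n),
  middle (S n) = grid m & decrease n = level_gain m].

(** The bound on [decrease] persists by monotonicity, so [filling_step] can be iterated until all
    coarse cells are used up. The clause on [f] records that every new point lies in [1/6, 5/6]; it
    serves for the plateau function. *)
Lemma phase m n : phase_start m n -> forall i, (i <= 2 ^ m.+1)%N ->
  [/\ filling_state m (n + i)%N, #|` middle (S (n + i)%N)| = ((2 ^ m.+1).+1 + i)%N,
      avg_dist (S (n + i)%N) = avg_dist (S n) - i%:R * level_gain m &
      forall f : R -> R, (forall x, 1 / 6 <= x <= 5 / 6 -> f x = 1) ->
        \sum_(x <- S (n + i)%N) f x = \sum_(x <- S n) f x + i%:R].
Proof.
move=> [n2 out mE dE]; elim=> [|i IH] im.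
  rewrite addn0 mE card_grid addn0 mul0r subr0; split=> //; last first.
    by move=> f _; rewrite addr0.
  split=> //; last by rewrite mE grid_sub.
  by apply/fsubsetP => x; rewrite -mE in_middle => /andP[].
have [fill card avg sumf] := IH (ltnW im).
have ni0 : (0 < n + i)%N by lia.
have lt : (#|` middle (S (n + i)%N)| < #|` @grid R m.+1|)%N.
  by rewrite card card_grid [in X in (_ < X)%N]expnS; lia.
have le : decrease (n + i)%N <= level_gain m.
  by rewrite -dE decrease_le//; lia.
have [deq fill' ain card'] := filling_step ni0 fill lt le.
rewrite addnS; split=> //.
- by rewrite card' card addnS.
- by move: deq; rewrite /decrease avg -natr1; lra.
- move=> f f1; have [[aS _ _ _] SE] := addedP ni0.
  by rewrite SE big_fsetU1//= f1// sumf// -natr1; ring.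
Qed.

(** The middle part is contained in the finer grid and has as many points. *)
Lemma phase_end m n : phase_start m n ->
  outer_state (S (n + 2 ^ m.+1)%N) /\ middle (S (n + 2 ^ m.+1)%N) = grid m.+1.
Proof.
move=> /phase/(_ (2 ^ m.+1)%N (leqnn _))[[out _ sub] card _ _]; split=> //.
apply/eqP; rewrite eqEfcard sub card card_grid.
by rewrite [X in (X.+1 <= _)%N]expnS; lia.
Qed.

(** While the decrease exceeds [level_gain m], the added point lies outside [1/6, 5/6], because a
    cell of the grid would yield only [level_gain m]. As [F] is nonnegative, this happens finitely
    often. *)
Lemma phase_exists m n : (2 < n)%N -> outer_state (S n) ->
  middle (S n) = grid m -> exists2 n', (n <= n')%N & phase_start m n'.
Proof.
(* [K] bounds the number of remaining outer steps, each lowering [F] by more than [level_gain m]. *)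
have [K] : exists K : nat, avg_dist (S n) < K%:R * level_gain m.
  exists (Num.truncn (avg_dist (S n) / level_gain m)).+1.
  have lg0 : 0 < level_gain m :> R by rewrite -mesh_gain; have := @mesh_gt0 R m; nra.
  by rewrite -ltr_pdivrMr// truncnS_gt.
elim: K n => [|K IH] n.
  by rewrite mul0r ltNge avg_dist_ge0.
move=> avg n2 out mE.
have gS : (grid m `<=` S n)%fset.
  by apply/fsubsetP => x; rewrite -mE in_middle => /andP[].
have mS : (middle (S n) `<=` grid m.+1)%fset by rewrite mE grid_sub.
have n0 : (0 < n)%N by lia.
have [p [q [gpq pq]]] : exists p q, gap (S n) p q /\ q - p = mesh m.
  by apply: unfilled_gap => //; rewrite mE !card_grid ltnS ltn_exp2l.
have := decrease_gap gpq; rewrite pq mesh_gain le_eqVlt => /predU1P[dE|dlt].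
  by exists n.
have S01 := @solution_in_unit n; have [best SE] := addedP n0.
have [[aout _]|[p' [q' [gpq' p1 q5 aE gE]]]] := best_outer S01 best out; last first.
  have [pS' qS' pq' _] := gpq'.
  have pg : p' \in grid m by rewrite -mE in_middle pS'; lra.
  have qg : q' \in grid m by rewrite -mE in_middle qS'; lra.
  by move: dlt; rewrite decreaseE// gE (grid_gap gS gpq' pg qg) mesh_gain ltxx.
have [||||n' nn' ph] := IH n.+1.
- by move: dlt avg; rewrite /decrease -natr1; lra.
- exact: ltnW.
- by rewrite SE; exact: outer_stateU1.
- by rewrite SE middleU1_out.
by exists n' => //; exact: ltnW.
Qed.

Lemma solution3 : outer_state (S 3) /\ middle (S 3) = grid 0.
Proof.
have S1 := solution1 Ssol.
suff S3 : S 3 =i [fset (1/6 : R); 1/2; 5/6]%fset.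
  have mem x : x \in S 3 = [|| x == 1/6, x == 1/2 | x == 5/6].
    by rewrite S3 !inE orbA.
  split; last first.
    apply/fsetP => x; rewrite in_middle mem; apply/idP/gridP.
      move=> /andP[/or3P[]/eqP-> _].
      - by exists 0%N; rewrite ?grid_point0.
      - by exists 1%N => //; rewrite /grid_point /mesh expr0; field.
      - by exists 2%N => //; rewrite /grid_point /mesh expr0; field.
    move=> [[|[|[|//]]] _ ->]; rewrite /grid_point /mesh expr0.
    - by rewrite mul0r addr0 eqxx/=; lra.
    - by rewrite (_ : _ + _ = 1/2 :> R) ?eqxx ?orbT/=; [lra|field].
    - by rewrite (_ : _ + _ = 5/6 :> R) ?eqxx ?orbT/=; [lra|field].
  split; first by rewrite !mem !eqxx !orbT.
  - exists (1/6); last by exists 0%N; rewrite mulr1.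
    by split=> [|x]; rewrite mem ?eqxx// => /or3P[]/eqP->; lra.
  - exists (5/6); last by exists 0%N; field.
    by split=> [|x]; rewrite mem ?eqxx ?orbT// => /or3P[]/eqP->; lra.
  move=> p q [+ + pq _]; rewrite !mem => /or3P[]/eqP pE /or3P[]/eqP qE; lra.
have [best1 S2] := addedP (ltn0Sn 0); have [best2 S3] := addedP (ltn0Sn 1).
have S0 := solution_neq0 (ltn0Sn 0); have S10 := solution_neq0 (ltn0Sn 1).
have := best_cases S0 (@solution_in_unit 1) best1.
have L1 : is_least (S 1) (1/2).
  by split; rewrite S1 ?inE// => x; rewrite inE => /eqP->.
have G1 : is_greatest (S 1) (1/2).
  by split; rewrite S1 ?inE// => x; rewrite inE => /eqP->.
(* The two end intervals of length [1/2] tie with gain [1/12]; whichever is cut first, the other is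
   cut next, its gain being larger than those of the new gap and the new end interval. *)
case=> [[p [q [[pS qS pq _] _ _]]]|[p [lp _ aE _]]|[p [gp _ aE _]]].
- by move: pS qS pq; rewrite S1 !inE => /eqP-> /eqP->; rewrite ltxx.
- rewrite (is_least_uniq lp L1) in aE.
  have a1 : added 1 = 1 / 6 by rewrite aE; field.
  have G2 : is_greatest (S 2) (1/2).
    by rewrite S2; apply: is_greatestU1_le => //; rewrite a1; lra.
  have L2 : is_least (S 2) (1/6).
    by rewrite S2 a1; apply: is_leastU1 L1 _; lra.
  have := best_greatest (@solution_in_unit 2) best2 G2.
  have := best_cases S10 (@solution_in_unit 2) best2.
  case=> [[p' [q' [[pS qS pq _] _ ->]]]|[p' [lp' _ _ ->]]|[p' [gp' _ a2E _]]].
  + by move: pS qS pq; rewrite S2 S1 !inE a1 => /orP[]/eqP-> /orP[]/eqP->; lra.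
  + by rewrite (is_least_uniq lp' L2); lra.
  move=> _ x; rewrite S3 S2 S1 a1 a2E (is_greatest_uniq gp' G2) !inE.
  by rewrite (_ : 1 - _ = 5/6); [do 3 case: (x == _)|field].
- rewrite (is_greatest_uniq gp G1) in aE.
  have a1 : added 1 = 5 / 6 by rewrite aE; field.
  have L2 : is_least (S 2) (1/2).
    by rewrite S2; apply: is_leastU1_ge => //; rewrite a1; lra.
  have G2 : is_greatest (S 2) (5/6).
    by rewrite S2 a1; apply: is_greatestU1 G1 _; lra.
  have := best_least (@solution_in_unit 2) best2 L2.
  have := best_cases S10 (@solution_in_unit 2) best2.
  case=> [[p' [q' [[pS qS pq _] _ ->]]]|[p' [lp' _ a2E _]]|[p' [gp' _ _ ->]]].
  + by move: pS qS pq; rewrite S2 S1 !inE a1 => /orP[]/eqP-> /orP[]/eqP->; lra.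
  + move=> _ x; rewrite S3 S2 S1 a1 a2E (is_least_uniq lp' L2) !inE.
    by rewrite (_ : 1 / 2 / 3 = 1/6); [do 3 case: (x == _)|field].
  by rewrite (is_greatest_uniq gp' G2); lra.
Qed.

Lemma phase_startP m : exists n, phase_start m n.
Proof.
suff [n [n2 out mE]] : exists n,
    [/\ (2 < n)%N, outer_state (S n) & middle (S n) = grid m].
  by have [n' _ ph] := phase_exists n2 out mE; exists n'.
elim: m => [|m [n [n2 out mE]]].
  by exists 3; have [] := solution3.
have [n' nn' ph] := phase_exists n2 out mE.
have [out' mE'] := phase_end ph; exists (n' + 2 ^ m.+1)%N; split=> //.
by case: ph => *; lia.
Qed.

End solutions.

(** * Separation of the points and failure of convergence *)

Section estimates.
Context {R : realType} (S : nat -> {fset R}).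
Context (Ssol : short_term_solutions S).
Implicit Types (x y z p q : R).

Lemma phase_start_ge m n : phase_start S m n -> (2 ^ m <= n)%N.
Proof.
move=> [_ _ mE _]; rewrite -[n in (_ <= n)%N](card_solution Ssol).
have /fsubset_leq_card : (grid m `<=` S n)%fset.
  by apply/fsubsetP => x; rewrite -mE in_middle => /andP[].
by rewrite card_grid; apply: leq_trans; rewrite expnS; lia.
Qed.

Lemma not_cvg_avg_dist : ~ cvgn (fun n : nat => n%:R * avg_dist (S n) : R).
Proof.
(* If the values at [n], [n + 2 ^ N] and [n + 2 ^ N.+1] were all within [1/200] of [L], their second
   difference would be less than [4/200] in absolute value, but it is [-1/36]. *)
move=> /cvg_ex[/= L /cvgrPdist_lt/(_ (1 / 200))].
have e0 : 0 < 1 / 200 :> R by lra.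
move=> /(_ e0)[N _ NL]; have [n ph] := phase_startP Ssol N.
have Nn : (N <= n)%N.
  by apply: leq_trans (phase_start_ge ph); apply: ltnW; exact: ltn_expl.
have [_ _ avg1 _] := phase Ssol ph (leq_pexp2l (ltn0Sn 1) (leqnSn N)).
have [_ _ avg2 _] := phase Ssol ph (leqnn _).
have := NL n Nn; have := NL (n + 2 ^ N)%N (leq_trans Nn (leq_addr _ _)).
have := NL (n + 2 ^ N.+1)%N (leq_trans Nn (leq_addr _ _)).
rewrite /= avg1 avg2 !natrD expnS natrM natrX.
have : (2 ^+ N) ^+ 2 * level_gain N = 1 / 72 :> R.
  rewrite -mesh_gain /mesh; have : 2 ^+ N != 0 :> R by rewrite expf_neq0.
  by move: (2%:R ^+ N) => a a0; field.
move: (2%:R ^+ N) (n%:R) (avg_dist _) (level_gain N) => M k s d Md.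
rewrite !ltr_norml; nra.
Qed.

(* The constant 4/3 comes from the end intervals: length e yields the new gap
   2e/3, with gain e^2/3. *)
Lemma separation n : (0 < n)%N -> {in S n &, forall x z, x < z ->
  4 / 3 * decrease S n <= (z - x) ^+ 2}.
Proof.
case: n => // n _; elim: n => [|n IH].
  by move=> x z; rewrite (solution1 Ssol) !inE => /eqP-> /eqP->; rewrite ltxx.
have dS := decreaseS Ssol (ltn0Sn n); have d0 := decrease_gt0 Ssol (ltn0Sn n).
have [best SE] := addedP Ssol (ltn0Sn n).
have dE := decreaseE Ssol (ltn0Sn n).
(* Pairs of old points inherit the bound because [decrease] does not grow, so only distances to the
   new point remain. *)
suff new x : x \in S n.+1 -> 4 / 3 * decrease S n.+1 <= (added S n.+1 - x) ^+ 2.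
  move=> x z; rewrite SE => /fset1UP[->|xS] /fset1UP[->|zS] xz.
  - by rewrite ltxx in xz.
  - by have := new _ zS; lra.
  - by have := new _ xS; lra.
  - by have := IH _ _ xS zS xz; lra.
move=> xS; rewrite dE; have S0 := solution_neq0 Ssol (ltn0Sn n).
have [[p [q [[pS qS pq pSq] -> ->]]]|[p [[pS Sp] p0 -> ->]]|[p [[pS Sp] p1 -> ->]]] :=
  best_cases S0 (@solution_in_unit _ _ Ssol n.+1) best.
- by have /orP[xp|qx] := pSq _ xS; nra.
- by have := Sp _ xS; nra.
- by have := Sp _ xS; nra.
Qed.

(** * Sorted points and their spacing *)

Definition points n := sort <=%R (S n).

Lemma size_points n : size (points n) = n.
Proof. by rewrite size_sort (card_solution Ssol). Qed.

Lemma mem_points n : points n =i S n.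
Proof. by move=> x; rewrite mem_sort. Qed.

Lemma points_lt n i j : (i < n)%N -> (j < n)%N ->
  ((points n)`_i < (points n)`_j) = (i < j)%N.
Proof.
move=> ni nj; apply: lt_sorted_ltn_nth; rewrite ?inE ?size_points//.
by rewrite sort_lt_sorted fset_uniq.
Qed.

Lemma points_le n i j : (i < n)%N -> (j < n)%N ->
  ((points n)`_i <= (points n)`_j) = (i <= j)%N.
Proof. by move=> ni nj; rewrite leNgt points_lt// -leqNgt. Qed.

Lemma mem_points_nth n i : (i < n)%N -> (points n)`_i \in S n.
Proof. by move=> ni; rewrite -mem_points mem_nth// size_points. Qed.

Lemma points_gap n i : (i.+1 < n)%N -> gap (S n) (points n)`_i (points n)`_i.+1.
Proof.
move=> i1; have i0 := ltnW i1; split; rewrite ?mem_points_nth ?points_lt//.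
move=> x; rewrite -mem_points => /(nthP 0)[j]; rewrite size_points => jn <-.
by rewrite !points_le// leqNgt orNb.
Qed.

Lemma separated_le n (d : R) : (0 < n)%N ->
  {in S n &, forall x z, x < z -> d <= z - x} -> (n%:R - 1) * d <= 1.
Proof.
case: n => // n _ sep.
have step i : (i <= n)%N -> i%:R * d <= (points n.+1)`_i - (points n.+1)`_0.
  elim: i => [|i IH] ni; first by rewrite mul0r subrr.
  have i0 : (i < n.+1)%N by exact: ltnW.
  have i1 : (i.+1 < n.+1)%N by [].
  have := sep _ _ (mem_points_nth i0) (mem_points_nth i1).
  rewrite points_lt// ltnSn => /(_ isT).
  by have := IH (ltnW ni); rewrite -natr1; lra.
have := step n (leqnn n); rewrite -natr1.
have := solution_in_unit Ssol (mem_points_nth (ltnSn n)).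
by have := solution_in_unit Ssol (mem_points_nth (ltn0Sn n)); lra.
Qed.

Lemma square_le_le x y : 0 <= y -> x ^+ 2 <= y ^+ 2 -> x <= y.
Proof. by move=> y0 xy; rewrite leNgt; apply/negP => yx; nra. Qed.

(** Squared distances are at least [4/3 * g^2/8 = g^2/6], hence at least [g^2/9], so the points are
    [g / 3] apart. Fitting them into [0, 1] gives [(n - 1) * g <= 3], and [n <= 2 * (n - 1)]. *)
Lemma decrease_bound n (g : R) : (1 < n)%N -> g ^+ 2 / 8 <= decrease S n ->
  n%:R * g <= 6.
Proof.
move=> n1 g8; have n0 := ltnW n1.
have : (n%:R - 1) * (g / 3) <= 1.
  apply: separated_le => // x z xS zS xz; apply: square_le_le; first lra.
  by have := separation n0 xS zS xz; have := sqr_ge0 g; lra.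
have : 2 <= n%:R :> R by rewrite (ler_nat _ 2).
by have [|] := lerP 0 g; nra.
Qed.

Lemma points_step n i : (i.+1 < n)%N ->
  n%:R * ((points n)`_i.+1 - (points n)`_i) <= 6.
Proof.
move=> i1; apply: decrease_bound; first by case: n i1 => [|[|]].
by apply: (decrease_gap Ssol); exact: points_gap.
Qed.

(** Every gap or end interval has length at most [6 / n], since its squared length over 8 is at most
    the best gain. *)
Lemma solution_net n x : (1 < n)%N -> 0 <= x <= 1 ->
  exists2 a, a \in S n & n%:R * `|x - a| <= 6.
Proof.
move=> n1 x01; have n0 := ltnW n1; have S0 := solution_neq0 Ssol n0.
have S01 := @solution_in_unit _ _ Ssol n; have [best _] := addedP Ssol n0.
have [xS|xS] := boolP (x \in S n); first by exists x; rewrite // subrr normr0 mulr0.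
have n00 : 0 <= n%:R :> R by [].
have [[p [q [gpq pxq]]]|[p Sp xp]|[p Sp px]] := gap_cases S0 xS.
- have [pS qS _ _] := gpq; exists p => //.
  have := decrease_bound n1 (decrease_gap Ssol gpq).
  by apply: le_trans; rewrite ler_wpM2l// ger0_norm; lra.
- exists p; first exact: Sp.1.
  have := best_least S01 best Sp; rewrite -decreaseE// => le.
  have /(decrease_bound n1) : p ^+ 2 / 8 <= decrease S n by nra.
  by apply: le_trans; rewrite ler_wpM2l// ler0_norm; lra.
- exists p; first exact: Sp.1.
  have := best_greatest S01 best Sp; rewrite -decreaseE// => le.
  have /(decrease_bound n1) : (1 - p) ^+ 2 / 8 <= decrease S n by nra.
  by apply: le_trans; rewrite ler_wpM2l// ger0_norm; lra.
Qed.

Lemma avg_dist_bound n : n%:R * avg_dist (S n) <= 6.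
Proof.
have [|n1] := leqP n 1; last first.
  have n0 : 0 < n%:R :> R by rewrite ltr0n ltnW.
  rewrite mulrC -ler_pdivlMr//.
  have -> : 6 / n%:R = \int[@lebesgue_measure R]_(x in `[0, 1]) (6 / n%:R).
    rewrite Rintegral_cst// [X in fine X]lebesgue_measure_itv/=.
    by rewrite lte01 oppr0 adde0 mulr1.
  apply: le_Rintegral => //.
  - exact: integrable_dist_set (solution_neq0 Ssol (ltnW n1)).
  - apply: continuous_compact_integrable; first exact: segment_compact.
    by apply: continuous_subspaceT => x; exact: cvg_cst.
  move=> x; rewrite /= in_itv/= => x01; have [a aS xa] := solution_net n1 x01.
  by apply: le_trans (dist_set_le x aS) _; rewrite ler_pdivlMr// mulrC.
case: n => [|[|//]] _; first by rewrite mul0r.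
by rewrite (solution1 Ssol) avg_dist1; lra.
Qed.

Lemma bounded_avg_dist : bounded_fun (fun n : nat => n%:R * avg_dist (S n) : R).
Proof.
exists 6; split=> // M M6 n _; apply: le_trans (ltW M6).
by rewrite ger0_norm ?avg_dist_bound// mulr_ge0// avg_dist_ge0.
Qed.

End estimates.

(** * Means of the plateau function *)

Section averages.
Context {R : realType} (S : nat -> {fset R}).
Context (Ssol : short_term_solutions S).
Implicit Types (x y z p q : R).

Definition plateau x : R := Num.min 1 (Num.min (6 * x) (6 * (1 - x))).

Lemma plateau_eq1 x : 1 / 6 <= x <= 5 / 6 -> plateau x = 1.
Proof. by move=> x6; rewrite /plateau min_l// le_min; lra. Qed.

Lemma plateau_bounds x : 0 <= x <= 1 -> 0 <= plateau x <= 1.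
Proof. by move=> x01; rewrite /plateau !le_min ge_min lexx; lra. Qed.

Lemma plateau_le x : plateau x <= 6 * x.
Proof. by rewrite /plateau !ge_min lexx orbT. Qed.

Lemma continuous_plateau : continuous plateau.
Proof.
move=> x; pose f1 (y : R) : R^o := 6 * y; pose f2 (y : R) : R^o := 6 * (1 - y).
suff : {for x, continuous ((cst 1 : R -> R^o) \min (f1 \min f2))} by [].
apply: continuous_min; first exact: cvg_cst.
apply: continuous_min.
  by apply: cvgM; [exact: cvg_cst|exact: cvg_id].
apply: cvgM; first exact: cvg_cst.
by apply: cvgB; [exact: cvg_cst|exact: cvg_id].
Qed.

Definition plateau_avg n := (\sum_(x <- S n) plateau x) / n%:R.

Lemma sum_plateau n : (0 < n)%N ->
  \sum_(x <- S n) plateau x = n%:R * plateau_avg n.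
Proof. by move=> n0; rewrite /plateau_avg mulrC divfK// pnatr_eq0 -lt0n. Qed.

Lemma plateau_avg_bounds n : 0 <= plateau_avg n <= 1.
Proof.
have [->|n0] := posnP n.
  by rewrite /plateau_avg invr0 mulr0 lexx ler01.
have b x : x \in S n -> 0 <= plateau x <= 1.
  by move=> /(solution_in_unit Ssol)/plateau_bounds.
apply/andP; split.
  rewrite divr_ge0// big_seq_cond; apply: sumr_ge0 => x; rewrite andbT => /b.
  by case/andP.
rewrite ler_pdivrMr ?ltr0n// mul1r big_seq_cond.
apply: (@le_trans _ _ (\sum_(x <- S n | (x \in S n) && true) 1)).
  by apply: ler_sum => x; rewrite andbT => /b/andP[].
rewrite -big_seq_cond big_const_seq iter_addr_0 count_predT.
by rewrite -[size _]/(#|` S n|) (card_solution Ssol).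
Qed.

(** Multiplied by [n.+1], the change of the mean is the new value minus the old mean, both in
    [0, 1]. *)
Lemma plateau_avg_step n : (0 < n)%N ->
  `|plateau_avg n.+1 - plateau_avg n| <= 1 / n.+1%:R.
Proof.
move=> n0; have [[aS a01 _ _] SE] := addedP Ssol n0.
have := sum_plateau (ltn0Sn n); rewrite SE big_fsetU1//= sum_plateau// -natr1.
have := plateau_avg_bounds n; have := plateau_bounds a01.
have : 0 <= n%:R :> R by [].
move: (plateau (added S n)) (plateau_avg n) (plateau_avg n.+1) (n%:R) =>
  f a a' k k0 f01 a01' E.
have k1 : 0 < k + 1 by lra.
rewrite ler_pdivlMr// -[X in _ * X]gtr0_norm// -normrM ler_norml.
have -> : (a' - a) * (k + 1) = f - a by lra.
by lra.
Qed.

(* Disjoint balls around evenly spaced points near 0 all meet [S n]. *)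
Lemma low_points n : (1 < n)%N -> exists s : seq R,
  [/\ uniq s, {subset s <= S n}, {in s, forall x, x <= 1 / 12} &
      size s = (n %/ 200)%N].
Proof.
move=> n1; have n0 : 0 < n%:R :> R by rewrite ltr0n ltnW.
(* The points are chosen near [13 * j / n]. As 13 exceeds twice the net constant 6, different [j]
   give different points; [200 * (j + 1) <= n] keeps [13 * j + 6] below [n / 12]. *)
have near j : exists a, (j < n %/ 200)%N ->
    [/\ a \in S n, a <= 1 / 12 & `|13 * j%:R - n%:R * a| <= 6].
  have [jn|] := boolP (j < n %/ 200)%N; last by exists 0.
  have jb : 200 * (j%:R + 1) <= n%:R :> R.
    rewrite natr1 -(natrM R 200) ler_nat.
    by apply: leq_trans (leq_trunc_div n 200); rewrite mulnC leq_mul2r jn orbT.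
  have j0 : 0 <= j%:R :> R by [].
  have [|a aS] := @solution_net _ _ Ssol n (13 * j%:R / n%:R) n1.
    rewrite divr_ge0 ?mulr_ge0//= ler_pdivrMr//; lra.
  rewrite -[X in X * _]gtr0_norm// -normrM mulrBr.
  rewrite [n%:R * (_ / _)]mulrC divfK ?gt_eqF// => le.
  exists a => _; split=> //; move: le; rewrite ler_norml => /andP[l1 l2].
  have : n%:R * a <= n%:R * (1 / 12) by lra.
  by rewrite ler_pM2l.
have [c cP] := choice near.
have c_inj (i j : nat) : (i < n %/ 200)%N -> (j < n %/ 200)%N -> c i = c j -> i = j.
  move=> /cP[_ _ ic] /cP[_ _ jc] ij; rewrite ij in ic.
  have {ic jc} : `|13 * i%:R - 13 * j%:R| < 13 :> R.
    by move: ic jc; rewrite !ler_norml ltr_norml; lra.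
  rewrite ltr_norml; have [|ji|->//] := ltngtP i j.
    by rewrite -(ler_nat R) -natr1 => h1 h2; exfalso; lra.
  by move: ji; rewrite -(ler_nat R) -natr1 => h1 h2; exfalso; lra.
exists [seq c j | j <- iota 0 (n %/ 200)]; split.
- rewrite map_inj_in_uniq ?iota_uniq// => i j; rewrite !mem_iota/= !add0n.
  exact: c_inj.
- by move=> _ /mapP[j + ->]; rewrite mem_iota/= => /cP[].
- by move=> _ /mapP[j + ->]; rewrite mem_iota/= => /cP[].
- by rewrite size_map size_iota.
Qed.

(** For these [n] the quotient [n %/ 200] is at least [n / 400], and each of the points near 0 falls
    short of 1 by at least [1/2]. *)
Lemma plateau_avg_le n : (200 <= n)%N -> plateau_avg n <= 1 - 1 / 800.
Proof.
move=> n200; have n0 : (0 < n)%N by lia.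
have [s [us sS s12 ss]] := low_points (leq_trans (isT : (1 < 200)%N) n200).
have nR : 0 < n%:R :> R by rewrite ltr0n.
suff : \sum_(x <- S n) (1 - plateau x) >= n%:R / 800.
  rewrite sumrB big_const_seq iter_addr_0 count_predT.
  rewrite -[size _]/(#|` S n|) (card_solution Ssol) sum_plateau// => le.
  have : n%:R * plateau_avg n <= n%:R * (1 - 1 / 800) by lra.
  by rewrite ler_pM2l.
rewrite (bigID (fun x => x \in s))/=.
have ge0 : 0 <= \sum_(x <- S n | x \notin s) (1 - plateau x).
  rewrite big_seq_cond; apply: sumr_ge0 => x /andP[xS _].
  by have := plateau_bounds (solution_in_unit Ssol xS); lra.
have : \sum_(x <- S n | x \in s) (1 / 2) <= \sum_(x <- S n | x \in s) (1 - plateau x).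
  by apply: ler_sum => x /s12; have := plateau_le x; lra.
rewrite big_const_seq iter_addr_0 -size_filter.
have -> : size [seq x <- S n | x \in s] = (n %/ 200)%N.
  rewrite -ss; apply/perm_size/uniq_perm => //.
    by rewrite filter_uniq// fset_uniq.
  move=> x; rewrite mem_filter; have [xs|//] := boolP (x \in s).
  by rewrite -[RHS](sS _ xs).
have : n%:R <= (n %/ 200)%:R * 400 :> R.
  rewrite -(natrM R _ 400) ler_nat.
  by have := divn_eq n 200; have := ltn_pmod n (isT : (0 < 200)%N); lia.
by rewrite -mulr_natl; lra.
Qed.

(** The gain [mesh m ^+ 2 / 8] makes the points [mesh m / 3] apart, so at most [9 * 2 ^ m + 1] of
    them fit. Thus the length of a phase is comparable to [n]. *)
Lemma phase_start_le m n : phase_start S m n -> (n <= 10 * 2 ^ m)%N.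
Proof.
move=> [n2 _ _ dE]; have n0 : (0 < n)%N by lia.
have mesh0 := @mesh_gt0 R m.
have : (n%:R - 1) * (mesh m / 3) <= 1 :> R.
  apply: (separated_le Ssol) => // x z xS zS xz; apply: square_le_le; first lra.
  have := separation Ssol n0 xS zS xz; rewrite dE -mesh_gain; nra.
rewrite -(ler_nat R) natrM natrX /mesh.
have : 1 <= 2 ^+ m :> R by rewrite exprn_ege1// ler1n.
move: (2%:R ^+ m) (n%:R) => a k a1.
rewrite (_ : (k - 1) * _ = (k - 1) / (9 * a)); last by field; lra.
by rewrite ler_pdivrMr; lra.
Qed.

(** With [K = 2 ^ m.+1] new points of value 1, a mean [a] grows by [K * (1 - a) / (n + K)]. Here
    [n <= 5 * K] and [1 - a >= 1/800], giving [1/6 * 1/800]. *)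
Lemma plateau_avg_phase m n : (200 <= n)%N -> phase_start S m n ->
  plateau_avg n + 1 / 4800 <= plateau_avg (n + 2 ^ m.+1)%N.
Proof.
move=> n200 ph; have n0 : (0 < n)%N by lia.
have [_ _ _ /(_ plateau plateau_eq1)] := phase Ssol ph (leqnn _).
rewrite !sum_plateau ?addn_gt0 ?n0// natrD.
have le := plateau_avg_le n200.
have nm : n%:R <= 5 * (2 ^ m.+1)%:R :> R.
  rewrite -(natrM R 5) ler_nat; have := phase_start_le ph.
  by rewrite [in X in _ -> X]expnS; lia.
have nR : 0 < n%:R :> R by rewrite ltr0n.
move: nm le; move: (plateau_avg n) (plateau_avg _) (n%:R) nR ((2 ^ m.+1)%:R) =>
  a a' k k0 K kK a1 E.
have kK0 : 0 < k + K by lra.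
rewrite -(ler_pM2l kK0) E; nra.
Qed.

(** Let [l] be a cluster value of the means at phase starts. During a phase the mean rises by at
    least [d], so it passes every [c] slightly above [l]; just before it first exceeds [c], it is
    within one step of [c]. *)
Lemma plateau_avg_crossing : exists c1 c2 : R, c1 < c2 /\
  forall c, c1 < c < c2 -> forall N, exists2 n, (N <= n)%N &
    `|plateau_avg n - c| <= 1 / n.+1%:R.
Proof.
have [d d0 phaseP] : exists2 d : R, 0 < d & forall m n, (200 <= n)%N ->
    phase_start S m n -> plateau_avg n + d <= plateau_avg (n + 2 ^ m.+1)%N.
  exists (1 / 4800); last by move=> m n n200 ph; exact: plateau_avg_phase n200 ph.
  by rewrite divr_gt0 ?ltr01 ?ltr0n.
have [nn nnP] := choice (phase_startP Ssol).
have nn_ge m : (m <= nn m)%N.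
  by apply: leq_trans (phase_start_ge Ssol (nnP m)); apply: ltnW; exact: ltn_expl.
have [|g ginc] := @bolzano_weierstrass R (plateau_avg \o nn).
  exists 1; split=> // M M1 n _; apply: le_trans (ltW M1).
  by rewrite /= ger0_norm; have /andP[] := plateau_avg_bounds (nn n).
move=> /cvg_ex[/= l gl].
exists l, (l + d / 2); split; first lra.
move=> c /andP[lc cl] N.
(* The tolerance [c - l] puts the phase start below [c]; the tolerance [d / 2] puts the phase end
   above [l + d / 2], hence above [c]. *)
have e0 : 0 < Num.min (c - l) (d / 2) by rewrite lt_min subr_gt0 lc; lra.
move/cvgrPdist_lt: gl => /(_ _ e0)[M _ Ml].
have gge k : (k <= g k)%N.
  elim: k => [//|k IH]; apply: leq_ltn_trans IH _.
  by rewrite (leqW_mono ginc).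
pose k := maxn M (maxn N 200); have /Ml/= := leq_maxl M (maxn N 200).
rewrite -/k lt_min !ltr_norml => /andP[d1 d2].
set n := nn (g k) in d1 d2.
have kn : (k <= n)%N by apply: leq_trans (gge k) _; exact: nn_ge.
have Nn : (N <= n)%N by apply: leq_trans kn; rewrite !leq_max leqnn orbT.
have n200 : (200 <= n)%N by apply: leq_trans kn; rewrite !leq_max leqnn !orbT.
have up := phaseP _ _ n200 (nnP (g k)).
have : exists i, c < plateau_avg (n + i)%N.
  by exists (2 ^ (g k).+1)%N; apply: lt_le_trans up; lra.
move=> /ex_minnP[[|i] ci imin]; first by move: ci; rewrite addn0; lra.
have ic : plateau_avg (n + i)%N <= c.
  by rewrite leNgt; apply/negP => /imin; rewrite ltnn.
exists (n + i)%N; first exact: leq_trans (leq_addr _ _).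
have := @plateau_avg_step (n + i)%N; rewrite addnS in ci.
have -> : (0 < n + i)%N by rewrite addn_gt0 (leq_trans _ n200).
by move=> /(_ isT); move: (1 / _) => e; rewrite !ler_norml; lra.
Qed.

Lemma increasing_subsequence (P : nat -> Prop) :
  (forall N, exists2 n, (N <= n)%N & P n) ->
  exists2 phi : nat -> nat, increasing_seq phi & forall k, P (phi k).
Proof.
move=> PN; have [|h hP] := @choice _ _ (fun N n => (N <= n)%N /\ P n).
  by move=> N; have [n] := PN N; exists n.
exists (fun k => iter k (fun n => h n.+1) (h 0%N)); last first.
  by case=> [|k] /=; [exact: (hP 0%N).2|exact: (hP _).2].
by apply/increasing_seqP => k /=; exact: (hP _).1.
Qed.

Lemma plateau_avg_cluster : exists c1 c2 : R, c1 < c2 /\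
  forall c, c1 < c < c2 -> exists2 phi : nat -> nat, increasing_seq phi &
    plateau_avg \o phi @ \oo --> c.
Proof.
have [c1 [c2 [c12 cross]]] := plateau_avg_crossing.
exists c1, c2; split=> // c /cross/increasing_subsequence[phi phi_inc phiP].
exists phi => //; apply/cvgrPdist_le => e e0.
have ge k : (k <= phi k)%N.
  elim: k => [//|k IH]; apply: leq_ltn_trans IH _.
  by rewrite (leqW_mono phi_inc).
exists (Num.truncn (1 / e)) => // k /= ek; rewrite distrC.
apply: le_trans (phiP k) _; rewrite ler_pdivrMr ?ltr0n// mulrC -ler_pdivrMr//.
apply: ltW; apply: lt_le_trans (truncnS_gt _) _.
by rewrite ler_nat ltnS (leq_trans ek).
Qed.

End averages.

(** * Diagonal extraction and step functions *)

Section compactness.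
Context {R : realType}.
Implicit Types (x y z u v : R).

Lemma increasing_seq_ge (phi : nat -> nat) : increasing_seq phi ->
  forall k, (k <= phi k)%N.
Proof.
move=> inc; elim=> [//|k IH]; apply: leq_ltn_trans IH _.
by rewrite (leqW_mono inc).
Qed.

Lemma increasing_seq_lt (phi : nat -> nat) i j : increasing_seq phi ->
  (i < j)%N -> (phi i < phi j)%N.
Proof. by move=> inc ij; rewrite (leqW_mono inc). Qed.

Lemma increasing_seq_comp (f g : nat -> nat) :
  increasing_seq f -> increasing_seq g -> increasing_seq (f \o g).
Proof. by move=> fi gi m n; rewrite /= fi; exact: gi. Qed.

Lemma diagonal_extraction (a : nat -> nat -> R) :
  (forall j n, 0 <= a j n <= 1) ->
  exists2 chi : nat -> nat, increasing_seq chi & forall j, cvgn (a j \o chi).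
Proof.
move=> a01.
have ext (p : {f : nat -> nat | increasing_seq f} * nat) :
    exists g : {f : nat -> nat | increasing_seq f},
      cvgn (a p.2 \o (sval p.1 \o sval g)).
  have [|g ginc gcvg] := @bolzano_weierstrass R (a p.2 \o sval p.1).
    exists 1; split=> // M M1 n _; apply: le_trans (ltW M1).
    by rewrite /= ger0_norm; have /andP[] := a01 p.2 (sval p.1 n).
  by exists (exist _ g ginc).
have [G GP] := choice ext.
have id_inc : increasing_seq (id : nat -> nat) by [].
pose next f j : {f : nat -> nat | increasing_seq f} :=
  exist _ (sval f \o sval (G (f, j)))
    (increasing_seq_comp (svalP f) (svalP (G (f, j)))).
(* Stage [j.+1] refines stage [j] so that [a j] converges along it; the diagonal takes the [k]-th
   term of stage [k]. *)
pose Phi := fix Phi k := if k is j.+1 then next (Phi j) j else exist _ id id_inc.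
exists (fun k => sval (Phi k) k).
  apply/increasing_seqP => k /=.
  apply: (increasing_seq_lt (svalP (Phi k))).
  exact: (increasing_seq_ge (svalP (G (Phi k, k)))).
move=> j.
(* Later stages are subsequences of stage [j.+1] whose indices never move backwards, so the tail of
   the diagonal inherits the limit. *)
have tail k : (j < k)%N -> forall i, exists2 i', (i <= i')%N &
    sval (Phi k) i = sval (Phi j.+1) i'.
  elim: k => // k IH; rewrite ltnS leq_eqVlt => /predU1P[<- i|jk i]; first by exists i.
  have [i' ii' E] := IH jk (sval (G (Phi k, k)) i); exists i' => //.
  exact: leq_trans (increasing_seq_ge (svalP (G (Phi k, k))) i) ii'.
have /cvg_ex[/= l lP] := GP (Phi j, j).
apply/cvg_ex; exists l => /=; apply/cvgrPdist_lt => e e0.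
move/cvgrPdist_lt : lP => /(_ e e0)[N _ NP].
exists (maxn N j.+1) => // k /=; rewrite geq_max => /andP[Nk jk].
have [i' ki' ->] := tail k jk k.
by apply: NP => /=; exact: leq_trans Nk ki'.
Qed.

(** * Step functions on equal subdivisions *)

Definition step_fun n (h : nat -> R) u : R :=
  \sum_(i < n) h i * \1_(`[i%:R / n%:R, i.+1%:R / n%:R[) u.

Lemma step_funE n h u i : (i < n)%N -> i%:R <= n%:R * u < i.+1%:R ->
  step_fun n h u = h i.
Proof.
move=> ni iu; have n0 : 0 < n%:R :> R by rewrite ltr0n (leq_ltn_trans _ ni).
have memE j : (u \in (`[j%:R / n%:R, j.+1%:R / n%:R[%classic : set R)) =
    (j%:R <= n%:R * u < j.+1%:R).
  by rewrite mem_setE in_itv/= ler_pdivrMr// ltr_pdivlMr// mulrC.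
rewrite /step_fun (bigD1 (Ordinal ni))//= big1 ?addr0.
  by rewrite indicE memE iu mulr1.
move=> j; rewrite -val_eqE/= => ji; rewrite indicE memE.
suff -> : (j%:R <= n%:R * u < j.+1%:R) = false by rewrite mulr0.
apply/negbTE; apply: contra ji => /andP[ju uj]; move: iu => /andP[iu ui].
have := le_lt_trans iu uj; have := le_lt_trans ju ui.
by rewrite !ltr_nat !ltnS eqn_leq => -> ->.
Qed.

Lemma step_fun_out n h u : ~~ (0 <= u < 1) -> step_fun n h u = 0.
Proof.
move=> uout; apply: big1 => i _; rewrite indicE mem_setE in_itv/=.
have n0 : 0 < n%:R :> R by rewrite ltr0n (leq_ltn_trans _ (ltn_ord i)).
suff -> : (i%:R / n%:R <= u < i.+1%:R / n%:R) = false by rewrite mulr0.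
apply/negbTE; apply: contra uout => /andP[iu ui]; apply/andP; split.
  by apply: le_trans iu; rewrite divr_ge0.
by apply: lt_le_trans ui _; rewrite ler_pdivrMr// mul1r ler_nat.
Qed.

Lemma step_index n u : 0 <= u < 1 -> (0 < n)%N ->
  exists2 i, (i < n)%N & i%:R <= n%:R * u < i.+1%:R.
Proof.
move=> /andP[u0 u1] n0; have nu0 : 0 <= n%:R * u by rewrite mulr_ge0.
exists (Num.truncn (n%:R * u)); last exact: truncn_itv.
rewrite truncn_lt_nat// -[X in _ < X]mulr1 ltr_pM2l// ltr0n//.
Qed.

Lemma measurable_step_fun n h : measurable_fun setT (step_fun n h).
Proof.
by apply: measurable_sum => i; apply: measurable_funM.
Qed.

Notation mu := (@lebesgue_measure R).

Lemma integrable_unit_itv (f : R -> R) (M : R) : measurable_fun setT f ->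
  (forall x, `|f x| <= M) -> mu.-integrable `[0, 1] (EFin \o f).
Proof.
move=> mf fM; apply: measurable_bounded_integrable => //.
- by rewrite /= lebesgue_measure_itv/= lte01 oppr0 adde0 ltry.
- exact: measurable_funTS.
- exists M; split; first exact: num_real.
  by move=> N MN x _; apply: le_trans (fM x) _; exact: ltW.
Qed.

Lemma Rintegral_step_fun n h :
  \int[mu]_(u in `[0, 1]) step_fun n h u = (\sum_(i < n) h i) / n%:R.
Proof.
rewrite /Rintegral /step_fun.
under eq_integral do rewrite -sumEFin.
rewrite integral_sum//; last first.
  move=> i; apply: (@integrable_unit_itv _ `|h i|) => [|x].
    by apply: measurable_funM => //; exact: measurable_indic.
  rewrite normrM ler_piMr// indicE; case: (_ \in _); rewrite ?normr1 ?normr0//.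
rewrite (eq_bigr (fun i : 'I_n => (h i / n%:R)%:E)); last first.
  move=> i _; under eq_integral do rewrite EFinM.
  rewrite integralZl//; last first.
    apply: (@integrable_unit_itv _ 1) => [|x]; first exact: measurable_indic.
    by rewrite indicE; case: (_ \in _); rewrite ?normr1 ?normr0.
  rewrite integral_indic// setIidl; last first.
    have n0 : 0 < n%:R :> R by rewrite ltr0n (leq_ltn_trans _ (ltn_ord i)).
    move=> x /=; rewrite !in_itv/= => /andP[ix xi]; apply/andP; split.
      by apply: le_trans ix; rewrite divr_ge0.
    by apply/ltW/(lt_le_trans xi); rewrite ler_pdivrMr// mul1r ler_nat.
  have n0 : 0 < n%:R :> R by rewrite ltr0n (leq_ltn_trans _ (ltn_ord i)).
  rewrite [X in (_ * X)%E]lebesgue_measure_itv/= lte_fin ltr_pM2r ?invr_gt0//.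
  by rewrite ltr_nat ltnSn -EFinD -EFinM -mulrBl -natr1 addrC addKr mul1r.
by rewrite sumEFin/= mulr_suml.
Qed.

End compactness.

(** * Quantile functions and uniform measures *)

Section quantiles.
Context {R : realType} (S : nat -> {fset R}).
Context (Ssol : short_term_solutions S).
Implicit Types (x y z u v : R).
Notation mu := (@lebesgue_measure R).

(** For [0 < n] it transports Lebesgue measure on [0, 1] to the uniform measure on [S n], so that
    weak limits of measures can be obtained from pointwise limits of functions. *)
Definition quantile n := step_fun n (fun i => (points S n)`_i).

Lemma quantile_comp n (F : R -> R) u : (0 < n)%N -> 0 <= u < 1 ->
  F (quantile n u) = step_fun n (fun i => F (points S n)`_i) u.
Proof.
move=> n0 /step_index/(_ n0)[i ni iu].
by rewrite (step_funE _ ni iu) /quantile (step_funE _ ni iu).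
Qed.

Lemma quantile_bounds n u : 0 <= quantile n u <= 1.
Proof.
have [n0|n0] := posnP n; first by rewrite /quantile n0 /step_fun big_ord0 lexx ler01.
rewrite /quantile; have [u01|/step_fun_out->] := boolP (0 <= u < 1); last first.
  by rewrite lexx ler01.
have [i ni iu] := step_index u01 n0; rewrite (step_funE _ ni iu).
by apply: (solution_in_unit Ssol); exact: mem_points_nth.
Qed.

Lemma points_diff n i j : (i <= j)%N -> (j < n)%N ->
  n%:R * ((points S n)`_j - (points S n)`_i) <= 6 * (j%:R - i%:R).
Proof.
elim: j => [|j IH]; first by rewrite leqn0 => /eqP->; rewrite !subrr !mulr0.
rewrite leq_eqVlt => /predU1P[->|ij] jn; first by rewrite !subrr !mulr0.
have := points_step Ssol jn; have := IH ij (ltnW jn).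
by rewrite -[j.+1%:R]natr1; lra.
Qed.

(** The indices of the cells of [u] and [v] differ by at most [n * |u - v| + 1], and each index step
    costs at most [6 / n]. *)
Lemma quantile_dist n u v : (0 < n)%N -> 0 <= u < 1 -> 0 <= v < 1 ->
  n%:R * `|quantile n u - quantile n v| <= 6 * (n%:R * `|u - v| + 1).
Proof.
move=> n0; wlog uv : u v / u <= v => [hw u01 v01|u01 v01].
  have [uv|vu] := leP u v; first exact: hw.
  by rewrite distrC (distrC u); apply: hw => //; exact: ltW.
have [i ni /andP[iu ui]] := step_index u01 n0.
have [j nj /andP[jv vj]] := step_index v01 n0.
rewrite /quantile (step_funE _ ni) ?iu// (step_funE _ nj) ?jv//.
have nR : 0 <= n%:R :> R by [].
have nuv : n%:R * u <= n%:R * v by rewrite ler_wpM2l.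
have ij : (i <= j)%N.
  by rewrite -ltnS -(ltr_nat R) (le_lt_trans iu)// (le_lt_trans nuv).
have pd := points_diff ij nj; rewrite -natr1 in ui.
rewrite [X in _ * X <= _]ler0_norm; last by rewrite subr_le0 (points_le Ssol).
rewrite [X in _ * X + 1]ler0_norm; last by rewrite subr_le0.
lra.
Qed.

Lemma bounded_Rintegral_itvco (f : R -> R) (M : R) : measurable_fun setT f ->
  (forall x, `|f x| <= M) ->
  \int[mu]_(x in `[0, 1[) f x = \int[mu]_(x in `[0, 1]) f x.
Proof.
move=> mf fM; apply: Rintegral_itv_bndo_bndc.
apply: integrableS (integrable_unit_itv mf fM) => //.
exact: subset_itv_co_cc.
Qed.

Lemma Rintegral_quantile n (F : R -> R) (M : R) : (0 < n)%N ->
  measurable_fun setT F -> (forall x, `|F x| <= M) ->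
  \int[mu]_(u in `[0, 1]) F (quantile n u) = (\sum_(x <- S n) F x) / n%:R.
Proof.
move=> n0 mF FM.
have M0 : 0 <= M by apply: le_trans (FM 0).
pose g := step_fun n (fun i => F (points S n)`_i).
have mFq : measurable_fun setT (fun u => F (quantile n u)).
  by apply: measurableT_comp => //; exact: measurable_step_fun.
(* The endpoint [1] is removed: there the quantile function takes the default [0], so the integrand
   is [F 0] while [g] vanishes. *)
rewrite -(@bounded_Rintegral_itvco _ M)//.
transitivity (\int[mu]_(u in `[0, 1[) g u).
  by apply: eq_Rintegral => u; rewrite inE/= in_itv/= => u01; exact: quantile_comp.
rewrite (@bounded_Rintegral_itvco _ M); last 2 first.
- exact: measurable_step_fun.
- move=> u; rewrite /g; have [u01|/step_fun_out->] := boolP (0 <= u < 1).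
    by rewrite -quantile_comp.
  by rewrite normr0.
rewrite /g Rintegral_step_fun; congr (_ / _).
rewrite (perm_big (points S n)); last by rewrite perm_sym perm_sort.
by rewrite (big_nth 0) size_points// big_mkord.
Qed.

(** Diagonal extraction gives convergence at the rationals, and the asymptotic Lipschitz bound
    carries it to every point, as in the theorem of Arzela and Ascoli. *)
Lemma quantile_cvg (psi : nat -> nat) : increasing_seq psi ->
  exists2 chi : nat -> nat, increasing_seq chi &
    forall u, cvgn (fun k => quantile (psi (chi k)) u).
Proof.
move=> psi_inc.
pose r (j : nat) : R := oapp ratr 0 (@choice.unpickle rat j).
have [|chi chi_inc chiP] := @diagonal_extraction R (fun j n => quantile (psi n) (r j)).
  by move=> j n; exact: quantile_bounds.
exists chi => // u; have [u01|uout] := boolP (0 <= u < 1); last first.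
  rewrite (_ : (fun k => _) = cst 0); first exact: is_cvg_cst.
  by apply/funext => k; rewrite /quantile step_fun_out.
apply/cauchy_cvgP/cauchy_exP => e e0 /=.
(* The error splits into three thirds of [e]: [6 * (e / 18)] from moving to a nearby rational,
   [6 / n] once [18 / e <= n], and the convergence at that rational. The truncation to ]0, 1[ keeps
   it in the domain of [quantile_dist]. *)
have [q] : exists q : rat,
    ratr q \in `]Num.max 0 (u - e / 18), Num.min 1 (u + e / 18)[%R.
  apply: rat_in_itvoo; move: u01 => /andP[u0 u1].
  by rewrite gt_max !lt_min; apply/andP; split; apply/andP; split; lra.
rewrite in_itv/= gt_max lt_min => /andP[/andP[q0 qu] /andP[q1 uq]].
have /cvg_ex[/= l /cvgrPdist_lt lP] := chiP (choice.pickle q).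
have e3 : 0 < e / 3 by lra.
exists l; near=> k.
have e18 : 0 < e / 18 by lra.
have psik : (0 < psi (chi k))%N /\ 18 / e <= (psi (chi k))%:R.
  have kp : (k <= psi (chi k))%N.
    exact: leq_trans (increasing_seq_ge chi_inc k) (increasing_seq_ge psi_inc _).
  split; first by apply: leq_trans kp; near: k; exact: nbhs_infty_gt.
  apply: (@le_trans _ _ k%:R); last by rewrite ler_nat.
  by near: k; exact: nbhs_infty_ger.
have lk : `|l - quantile (psi (chi k)) (ratr q)| < e / 3.
  by have : `|l - quantile (psi (chi k)) (r (choice.pickle q))| < e / 3;
    [near: k; exact: lP|rewrite /r choice.pickleK].
have [n0 ne] := psik; rewrite /ball/=.
have qr01 : 0 <= (ratr q : R) < 1 by rewrite (ltW q0).
have := quantile_dist n0 qr01 u01.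
have nR : 0 < (psi (chi k))%:R :> R by rewrite ltr0n.
have dqu : `|ratr q - u| <= e / 18 by rewrite ler_norml; lra.
rewrite ler_pdivrMr// in ne.
move: (quantile _ _) (quantile _ _) lk nR ne dqu => a b la nR ne dqu ab.
have {}ab : `|b - a| <= 2 * e / 3.
  rewrite -(ler_pM2l nR); apply: le_trans ab _.
  by move: dqu; move: (`|_ - u|) => d dle; nra.
have := ler_distD b l a; lra.
Unshelve. all: by end_near. Qed.

(** Composition with it turns a function continuous on [0, 1] into a bounded continuous function on
    the line with the same values on [0, 1]. *)
Definition clamp x := Num.max 0 (Num.min 1 x).

Lemma clamp_id x : 0 <= x <= 1 -> clamp x = x.
Proof. by case/andP => x0 x1; rewrite /clamp (min_r x1) (max_r x0). Qed.

Lemma clamp_bounds x : 0 <= clamp x <= 1.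
Proof.
by rewrite /clamp le_max lexx ge_max ler01 ge_min lexx.
Qed.

Lemma clamp_dist x y : `|clamp x - clamp y| <= `|x - y|.
Proof.
have cl z : [\/ z <= 0 /\ clamp z = 0, 0 <= z <= 1 /\ clamp z = z |
    1 <= z /\ clamp z = 1].
  have [z0|z0] := leP z 0.
    by apply: Or31; split=> //; rewrite /clamp max_l// ge_min z0 orbT.
  have [z1|z1] := leP z 1; first by apply: Or32; rewrite clamp_id ltW.
  by apply: Or33; split; [exact: ltW|rewrite /clamp min_l ?ltW// max_r].
have := ler_norm (x - y); have := ler_norm (y - x); rewrite (distrC y x) => yx xy.
by have [[? ->]|[? ->]|[? ->]] := cl x; have [[? ->]|[? ->]|[? ->]] := cl y;
  rewrite ler_norml; lra.
Qed.

Lemma continuous_clamp (f : R -> R) : {within `[0, 1], continuous f} ->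
  continuous (f \o clamp).
Proof.
move=> /subspace_continuousP cf x.
have cx : `[0, 1]%classic (clamp x) by rewrite /= in_itv/=; exact: clamp_bounds.
have /cvgrPdist_lt fx := cf _ cx.
apply/cvgrPdist_lt => e e0; have := fx e e0; rewrite /within/= => -[d /= d0 dP].
near=> y => /=.
apply: dP => /=; last by rewrite in_itv/=; exact: clamp_bounds.
apply: le_lt_trans (clamp_dist x y) _.
by near: y; exact: cvgr_dist_lt.
Unshelve. all: by end_near. Qed.

Lemma continuous_clamp_bounded (f : R -> R) : {within `[0, 1], continuous f} ->
  exists M : R, forall x, `|(f \o clamp) x| <= M.
Proof.
move=> cf.
have cnf : {within `[0, 1], continuous (fun x => `|f x|)}.
  by move=> x; apply: cvg_norm; exact: cf.
have [c _ cM] := EVT_max (ler01 : (0 : R) <= 1) cnf.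
by exists `|f c| => x; apply: cM; rewrite in_itv/=; exact: clamp_bounds.
Qed.

End quantiles.

(** * Integrals against uniform measures *)

Section limit_measures.
Context {R : realType}.
Implicit Types (f F : R -> R).
Notation mu := (@lebesgue_measure R).
Local Notation borel := (measurableTypeR R).

Lemma measurable_unit_itv : measurable (`[0, 1]%classic : set borel).
Proof. exact: measurable_itv. Qed.

(** Reduces bounded integrands to the nonnegative function [F + M], to which the rules for scaled,
    summed and pushed forward measures apply. *)
Lemma Rintegral_shift (m : {measure set borel -> \bar R}) F (M : R) :
  m `[0, 1]%classic = 1%E -> measurable_fun setT F ->
  (forall x, `|F x| <= M) ->
  \int[m]_(x in `[0, 1]) (F x + M) = \int[m]_(x in `[0, 1]) F x + M.
Proof.
move=> m1 mF FM; have m01 := measurable_unit_itv.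
have fin : (m `[0%R, 1%R]%classic < +oo)%E by rewrite m1 ltry.
rewrite RintegralD//.
- by rewrite Rintegral_cst// [X in fine X]m1 mulr1.
- apply: measurable_bounded_integrable => //; first exact: measurable_funTS.
  exists M; split; first exact: num_real.
  by move=> N MN x _; apply: le_trans (FM x) _; exact: ltW.
- apply: measurable_bounded_integrable => //.
  exists `|M|; split; first exact: num_real.
  by move=> N MN x _; exact: ltW.
Qed.

Lemma ge0_Rintegral_unif_measure (A : {fset R}) F : in_unit A ->
  measurable_fun setT F -> (forall x, 0 <= F x) ->
  \int[unif_measure A]_(x in `[0, 1]) F x = (\sum_(x <- A) F x) / #|` A|%:R.
Proof.
move=> A01 mF F0; have m01 := measurable_unit_itv.
have mEF : measurable_fun (`[0, 1]%classic : set borel) (EFin \o F).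
  by apply/measurable_EFinP; exact: measurable_funTS.
rewrite /Rintegral /unif_measure ge0_integral_mscale//; last first.
  by move=> x _; rewrite lee_fin.
rewrite ge0_integral_measure_sum//; last by move=> x _; rewrite lee_fin.
rewrite (eq_bigr (fun i : 'I_#|` A| => (F (A : seq R)`_i)%:E)); last first.
  move=> i _; rewrite integral_dirac// diracE mem_set ?mul1e//=.
  by rewrite in_itv/=; apply: A01; exact: mem_nth.
by rewrite sumEFin/= mulrC [in RHS](big_nth 0) big_mkord.
Qed.

Lemma Rintegral_unif_measure (A : {fset R}) F (M : R) : A != fset0 -> in_unit A ->
  measurable_fun setT F -> (forall x, `|F x| <= M) ->
  \int[unif_measure A]_(x in `[0, 1]) F x = (\sum_(x <- A) F x) / #|` A|%:R.
Proof.
move=> A0 A01 mF FM; have cA : #|` A|%:R != 0 :> R by rewrite pnatr_eq0 cardfs_eq0.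
have m1 : unif_measure A `[0, 1]%classic = 1%E.
  rewrite -[RHS](unif_measureT A0); rewrite /unif_measure /mscale/= /msum.
  congr (_ * _)%E; apply: eq_bigr => i _.
  have d1 (B : set borel) : B (A : seq R)`_i ->
      dirac ((A : seq R)`_i : borel) B = 1%E :> \bar R.
    by move=> Bi; rewrite diracE mem_set.
  apply: etrans (d1 _ _) (esym (d1 _ _)) => //=.
  by rewrite in_itv/=; apply: A01; exact: mem_nth.
apply: (addIr M); rewrite -(Rintegral_shift m1 mF FM) ge0_Rintegral_unif_measure//.
- rewrite big_split/= mulrDl big_const_seq iter_addr_0 count_predT.
  by rewrite -[M *+ _]mulr_natr mulfK.
- exact: measurable_funD.
- by move=> x; have := FM x; rewrite ler_norml; lra.
Qed.

End limit_measures.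

(** * Limit measures *)

Section main.
Context {R : realType}.
Implicit Types (f F : R -> R).
Notation mu := (@lebesgue_measure R).
Local Notation borel := (measurableTypeR R).

(** Change of variables for the law of [X] under the uniform probability; it is used with a limit of
    quantile functions as [X]. *)
Lemma Rintegral_distribution_uniform (X : {mfun borel >-> borel}) F (M : R) :
  (forall u, 0 <= X u <= 1) -> measurable_fun setT F ->
  (forall x, `|F x| <= M) ->
  distribution (uniform_prob (@ltr01 R)) X `[0, 1]%classic = 1%E /\
  \int[distribution (uniform_prob (@ltr01 R)) X]_(x in `[0, 1]) F x =
    \int[mu]_(u in `[0, 1]) F (X u).
Proof.
move=> X01 mF FM; set m := distribution _ _.
have XT : X @^-1` `[0, 1]%classic = setT.
  by apply/seteqP; split=> // u _; rewrite /= in_itv/=; exact: X01.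
have m1 : m `[0, 1]%classic = 1%E.
  by rewrite /m /distribution /pushforward XT; exact: probability_setT.
split=> //.
have ge0 (G : R -> R) : measurable_fun setT G -> (forall x, 0 <= G x) ->
    \int[m]_(x in `[0, 1]) G x = \int[mu]_(u in `[0, 1]) G (X u).
  move=> mG G0; rewrite /Rintegral /m /distribution ge0_integral_pushforward//.
  - rewrite XT integral_uniform//=.
    + by rewrite subr0 invr1 mul1e.
    + by apply/measurable_EFinP; apply: measurableT_comp.
    + by move=> x; rewrite lee_fin.
  - by apply/measurable_EFinP; exact: measurable_funTS.
  - by move=> x _; rewrite lee_fin.
apply: (addIr M); rewrite -(Rintegral_shift m1 mF FM) ge0.
- have u1 : mu `[0, 1]%classic = 1%E.
    by rewrite [LHS]lebesgue_measure_itv/= lte01 oppr0 adde0.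
  rewrite (@Rintegral_shift _ mu (F \o X))//; last by move=> x; exact: FM.
  exact: measurableT_comp mF (measurable_funPT X).
- exact: measurable_funD.
- by move=> x; have := FM x; rewrite ler_norml; lra.
Qed.

Lemma eq_clamp (m : {measure set borel -> \bar R}) f :
  \int[m]_(x in `[0, 1]) f x = \int[m]_(x in `[0, 1]) (f \o clamp) x.
Proof.
by apply: eq_Rintegral => x; rewrite inE/= in_itv/= => x01; rewrite clamp_id.
Qed.

(** The measure is the law of the pointwise limit of quantile functions. The convergence along
    [psi \o chi] is stated separately so that an integral can be identified with a limit prescribed
    along [psi]. *)
Lemma limit_measure_exists (S : nat -> {fset R}) (psi : nat -> nat) :
  short_term_solutions S -> increasing_seq psi ->
  exists2 m : probability borel R, limit_measure (fun n => unif_measure (S n)) m &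
    exists2 chi : nat -> nat, increasing_seq chi &
      forall f, {within `[0, 1], continuous f} ->
      (\sum_(x <- S (psi (chi k))) f x) / (psi (chi k))%:R @[k --> \oo] -->
        \int[m]_(x in `[0, 1]) f x.
Proof.
move=> Ssol psi_inc; have [chi chi_inc qcvg] := quantile_cvg Ssol psi_inc.
pose q k u := quantile S (psi (chi k)) u.
pose Q (u : borel) : borel := limn (fun k => q k u).
have qQ u : q ^~ u @ \oo --> Q u by exact: qcvg.
have mq k : measurable_fun setT (q k) by exact: measurable_step_fun.
have mQ : measurable_fun setT Q by apply: (measurable_fun_cvg mq) => u _; exact: qQ.
have Q01 u : 0 <= Q u <= 1.
  have q01 k := quantile_bounds Ssol (psi (chi k)) u.
  apply/andP; split.
    by apply: limr_ge; [exact: qcvg|apply: nearW => k; have /andP[] := q01 k].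
  by apply: limr_le; [exact: qcvg|apply: nearW => k; have /andP[] := q01 k].
pose X : {mfun borel >-> borel} := mfun_Sub (mem_set mQ : Q \in mfun).
pose m : probability borel R := distribution (uniform_prob (@ltr01 R)) X.
have mf_lim f : {within `[0, 1], continuous f} ->
    (\sum_(x <- S (psi (chi k))) (f \o clamp) x) / (psi (chi k))%:R @[k --> \oo] -->
        \int[m]_(x in `[0, 1]) f x.
  move=> cf; have [M FM] := continuous_clamp_bounded cf.
  have cF := continuous_clamp cf; set F := f \o clamp in cF FM *.
  have mF : measurable_fun setT F by exact: continuous_measurable_fun.
  have [_ mE] := Rintegral_distribution_uniform (X := X) Q01 mF FM.
  rewrite (eq_clamp m) -/F mE.
  have M0 : 0 <= M by apply: le_trans (FM 0).
  have psi0 k : (0 < k)%N -> (0 < psi (chi k))%N.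
    move=> k0; apply: leq_trans k0 _.
    exact: leq_trans (increasing_seq_ge chi_inc k) (increasing_seq_ge psi_inc _).
  (* As soon as [psi (chi k)] is positive the means are integrals of [F] along quantile functions;
     these converge by domination by [M]. *)
  suff : \int[mu]_(u in `[0, 1]) F (q k u) @[k --> \oo] -->
      \int[mu]_(u in `[0, 1]) F (X u).
    apply: cvg_trans; apply: near_eq_cvg; near=> k.
    rewrite (Rintegral_quantile Ssol (M := M))//; apply: psi0.
    by near: k; exact: nbhs_infty_gt.
  apply: fine_cvg; rewrite fineK; last first.
    apply: integrable_fin_num => //; apply: (@integrable_unit_itv _ _ M) => //.
    exact: measurableT_comp.
  apply: (@dominated_cvg _ _ _ mu _ _ _ _ (cst M%:E)) => //.
  - move=> k; apply/measurable_EFinP/measurable_funTS.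
    exact: (measurableT_comp mF (mq k)).
  - move=> u _; apply/fine_cvgP; split; first exact: nearW.
    have Fq : F (q k u) @[k --> \oo] --> F (Q u).
      by apply: continuous_cvg; [exact: cF|exact: qQ].
    exact: Fq.
  - apply: (@integrable_unit_itv _ (cst M) M) => //.
    by move=> x; rewrite ger0_norm.
  - by move=> k u _; rewrite lee_fin; exact: FM.
have clampE k f : \sum_(x <- S k) (f \o clamp) x = \sum_(x <- S k) f x.
  rewrite big_seq_cond [RHS]big_seq_cond; apply: eq_bigr => x /andP[xS _] /=.
  by rewrite clamp_id//; exact: (solution_in_unit Ssol xS).
exists m; last first.
  exists chi => // f /mf_lim; apply: cvg_trans; apply: near_eq_cvg.
  by near=> k; rewrite clampE.
split.
  have [|x|//] := Rintegral_distribution_uniform (X := X) (F := cst (0 : R))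
    (M := 0) Q01; first exact: measurable_cst.
  by rewrite normr0.
exists (psi \o chi); first exact: increasing_seq_comp.
move=> f cf; have [M FM] := continuous_clamp_bounded cf.
have mF : measurable_fun setT (f \o clamp).
  exact: continuous_measurable_fun (continuous_clamp cf).
apply: cvg_trans (mf_lim f cf); apply: near_eq_cvg; near=> k.
rewrite /= eq_clamp (Rintegral_unif_measure (M := M))//.
- by rewrite (card_solution Ssol).
- apply: (solution_neq0 Ssol); apply: (@leq_trans k).
    by near: k; exact: nbhs_infty_gt.
  exact: leq_trans (increasing_seq_ge chi_inc k) (increasing_seq_ge psi_inc _).
- exact: solution_in_unit.
Unshelve. all: by end_near. Qed.

End main.

Theorem theorem4p9 (R : realType) :
  (forall S : nat -> {fset R}, short_term_solutions S ->
     bounded_fun (fun n : nat => n%:R * avg_dist (S n) : R) /\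
     ~ cvgn (fun n : nat => n%:R * avg_dist (S n) : R)) /\
  (forall S : nat -> {fset R}, short_term_solutions S ->
     infinite_set
       [set on_borel m | m in limit_measure (fun n => unif_measure (S n))]).
Proof.
split=> S Ssol; first by split; [exact: bounded_avg_dist|exact: not_cvg_avg_dist].
have [c1 [c2 [c12 cluster]]] := plateau_avg_cluster Ssol.
set L := limit_measure _.
have cf : {within `[0, 1], continuous (@plateau R)}.
  exact/continuous_subspaceT/continuous_plateau.
(* Infinitely many distinct targets; the denominator starts at 2 to stay strictly below [c2]. *)
pose c n : R := c1 + (c2 - c1) / n.+2%:R.
have c_in n : c1 < c n < c2.
  have n2 : 0 < n.+2%:R :> R by rewrite ltr0n.
  rewrite /c ltrDl divr_gt0 ?subr_gt0//= -ltrBrDl ltr_pdivrMr//.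
  by rewrite ltr_pMr ?subr_gt0// ltr1n.
have c_inj : injective c.
  have d0 : c2 - c1 != 0 by rewrite subr_eq0 gt_eqF.
  move=> i j /addrI /(mulfI d0)/invr_inj/eqP.
  by rewrite eqr_nat !eqSS => /eqP.
have m_ex n : exists m : probability (measurableTypeR R) R,
    L m /\ \int[m]_(x in `[0, 1]) plateau x = c n.
  have [psi psi_inc psic] := cluster _ (c_in n).
  have [m Lm [chi chi_inc /(_ _ cf) mlim]] := limit_measure_exists Ssol psi_inc.
  exists m; split=> //; apply: (cvg_unique _ mlim) => //.
  apply: (cvg_comp chi (plateau_avg S \o psi) _ psic) => A [N _ NA].
  exists N => // k Nk; apply: NA.
  exact: leq_trans Nk (increasing_seq_ge chi_inc k).
have [m_ m_P] := choice m_ex.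
(* Measures that agree on Borel sets give the plateau function the same integral, and these
   integrals are the distinct numbers [c n]. *)
have h_inj : injective (on_borel \o m_).
  move=> i j ij; apply: c_inj; rewrite -(m_P i).2 -(m_P j).2; congr fine.
  apply: eq_measure_integral => A mA _.
  by have := congr1 (fun h => h (exist _ A mA)) ij.
move=> finL; apply: infinite_nat.
rewrite -(eq_finite_set (inj_card_eq (in2W h_inj))).
by apply: sub_finite_set finL => _ [n _ <-]; exists (m_ n) => //; exact: (m_P n).1.
Qed.
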